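(* For every positive integer $k$ there is a constant $C=C(k)$ such that every graph $G$ with maximum degree $\Delta\geq 3$ and average degree at least $C\log\log\Delta$ contains a $k$-regular subgraph. In particular, every $n$-vertex graph ($n\geq 3$) with average degree at least $C\log\log n$ contains a $k$-regular subgraph.
   Context: All logarithms are to base $2$. The average degree of a graph with at least one vertex is $2e(G)/|V(G)|$. A $k$-regular subgraph means a (not necessarily spanning, non-empty) subgraph in which every vertex has degree exactly $k$. *)

(* Defs.v *)
From mathcomp Require Import all_boot.
From Stdlib Require Import Reals.
Set Implicit Arguments. Unset Strict Implicit. Unset Printing Implicit Defensive.

Definition simple_graph (T : finType) (e : rel T) : Prop :=
  symmetric e /\ irreflexive e.

Definition degree (T : finType) (e : rel T) (v : T) : nat := #|[set u | e v u]|.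

Definition max_degree (T : finType) (e : rel T) : nat := \max_(v : T) degree e v.

Definition num_edges (T : finType) (e : rel T) : nat :=
  #|[set A : {set T} | (#|A| == 2) &&
      [forall x in A, forall y in A, (x != y) ==> e x y]]|.

Definition avg_degree (T : finType) (e : rel T) : R :=
  (2 * INR (num_edges e) / INR #|T|)%R.

Definition log2 (x : R) : R := (ln x / ln 2)%R.

Definition has_k_regular_subgraph (T : finType) (e : rel T) (k : nat) : Prop :=
  exists (S : {set T}) (f : rel T),
    S != set0 /\ symmetric f /\
    (forall x y, f x y -> e x y) /\
    (forall x y, f x y -> (x \in S) && (y \in S)) /\
    (forall v, v \in S -> #|[set u | f v u]| = k).

(* Main.v *)
(** Let q >= k be prime.  By the argument of Alon, Friedland and Kalai (an
    alternating sum over edge subsets of a polynomial over F_q of low degree) a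
    bipartite graph with n vertices, more than (q - 1) n edges and maximum degree
    at most 2 q - 1 has a q-regular subgraph, and by max-flow min-cut (i) it
    suffices that, for some large t, all degrees are at most t and the average
    degree is close to t, and (ii) a q-regular bipartite graph has a k-regular
    subgraph.

    Consider a pair (X, Y) of sides in which every vertex of X has at least d
    neighbours in Y, and cap the degrees in X by s and those in Y by M.  Either
    there is a subgraph meeting the caps with about s #|X| edges, or a minimum cut
    yields X' and Y' with #|Y'| / #|X'| of order s / M such that vertices of X'
    still have d - O(s) neighbours in Y'.  Write rho = #|Y| / #|X|.  As long as
    rho is bounded below we take M = s / rho: success gives a nearly biregular
    graph, which becomes nearly regular after sampling X, and failure decreases rho
    by a constant factor.  Once rho is small we take M = rho ^ -(1 + epsilon):
    failure replaces rho by rho ^ (1 + epsilon / 2), which can happen only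
    O(log log Delta) times since rho >= 1 / Delta.  On success, the degrees in Y
    are polynomially related and the graph is regularised by keeping b in Y with
    probability proportional to deg b, and a in X only if all its neighbours are
    kept, with a correction making all vertices of X equally likely.  The second
    moment is under control if no two neighbours of a have large codegree, and
    unless there is a K_{q,q} this can be arranged by deleting edges. *)
Require Import Defs.
From mathcomp Require Import all_boot all_order all_algebra.
From mathcomp Require Import finfield zify ring lra.
Set Implicit Arguments. Unset Strict Implicit. Unset Printing Implicit Defensive.
Import Order.TTheory GRing.Theory Num.Theory.

(** * Degree-constrained subgraphs of bipartite graphs *)

Section Bipartite.
Variables A B : finType.
Implicit Types (E F : {set A * B}) (X : {set A}) (Y : {set B}).

Definition nbrA E a : {set B} := [set b | (a, b) \in E].
Definition nbrB E b : {set A} := [set a | (a, b) \in E].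
Definition edges_between E X Y := E :&: setX X Y.

(** Degrees are prescribed only at the ends of edges of [F], so a regular subgraph, spanning or not,
    is coded by its edge set alone. *)
Definition biregular k F :=
  F != set0 /\
  forall a b, (a, b) \in F -> #|nbrA F a| = k /\ #|nbrB F b| = k.

Lemma card_edgesA E : #|E| = \sum_a #|nbrA E a|.
Proof.
rewrite -sum1_card (partition_big fst predT) //=; apply: eq_bigr => a _.
rewrite sum1_card -(card_imset (nbrA E a) (_ : injective (pair a))); last first.
  by move=> b b' [].
apply: eq_card => -[a' b] /=; apply/andP/imsetP => [[h /eqP <-]|].
  by exists b; rewrite ?inE.
by move=> [b1 hb [-> ->]]; rewrite in_set in hb.
Qed.

Lemma card_edgesB E : #|E| = \sum_b #|nbrB E b|.
Proof.
rewrite -sum1_card (partition_big snd predT) //=; apply: eq_bigr => b _.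
rewrite sum1_card -(card_imset (nbrB E b) (_ : injective (pair^~ b))); last first.
  by move=> a a' [].
apply: eq_card => -[a b'] /=; apply/andP/imsetP => [[h /eqP <-]|].
  by exists a; rewrite ?inE.
by move=> [a1 ha [-> ->]]; rewrite in_set in ha.
Qed.

(** Capacity of the source side [X], [Y] in the network with arcs from the source to [a] of capacity
    [u a], edges of capacity 1, and arcs from [b] to the sink of capacity [v b]. *)
Definition cut (u : A -> nat) (v : B -> nat) E X Y :=
  (\sum_a (a \notin X) * u a + \sum_b (b \in Y) * v b +
   \sum_(e in E) (e.1 \in X) && (e.2 \notin Y))%N.

Lemma cut_submodular u v E X1 Y1 X2 Y2 :
  (cut u v E (X1 :&: X2) (Y1 :&: Y2) + cut u v E (X1 :|: X2) (Y1 :|: Y2)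
   <= cut u v E X1 Y1 + cut u v E X2 Y2)%N.
Proof.
rewrite /cut.
have hA : (\sum_a (a \notin X1 :&: X2) * u a + \sum_a (a \notin X1 :|: X2) * u a
  <= \sum_a (a \notin X1) * u a + \sum_a (a \notin X2) * u a)%N.
  rewrite -!big_split /=; apply: leq_sum => a _; rewrite !inE.
  by case: (a \in X1); case: (a \in X2) => /=; lia.
have hB : (\sum_b (b \in Y1 :&: Y2) * v b + \sum_b (b \in Y1 :|: Y2) * v b
  <= \sum_b (b \in Y1) * v b + \sum_b (b \in Y2) * v b)%N.
  rewrite -!big_split /=; apply: leq_sum => b _; rewrite !inE.
  by case: (b \in Y1); case: (b \in Y2) => /=; lia.
have hE : (\sum_(e in E) (e.1 \in X1 :&: X2) && (e.2 \notin Y1 :&: Y2)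
   + \sum_(e in E) (e.1 \in X1 :|: X2) && (e.2 \notin Y1 :|: Y2)
  <= \sum_(e in E) (e.1 \in X1) && (e.2 \notin Y1)
   + \sum_(e in E) (e.1 \in X2) && (e.2 \notin Y2))%N.
  rewrite -!big_split /=; apply: leq_sum => -[a b] _; rewrite !inE /=.
  by case: (a \in X1); case: (a \in X2); case: (b \in Y1); case: (b \in Y2).
lia.
Qed.

Lemma cut_edge u v E a b X Y : (a, b) \in E ->
  cut u v E X Y = (cut u v (E :\ (a, b)) X Y + ((a \in X) && (b \notin Y)))%N.
Proof.
by move=> abE; rewrite /cut (big_setD1 _ abE) /= [in LHS]addnCA addnC.
Qed.

Lemma cut_decr_cap u v E a b X Y : (0 < u a)%N -> (0 < v b)%N ->
  cut u v E X Y =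
  (cut (fun x => u x - (x == a)) (fun x => v x - (x == b)) E X Y
   + (a \notin X) + (b \in Y))%N.
Proof.
move=> ua vb; rewrite /cut.
have -> : (\sum_x (x \notin X) * u x =
    \sum_x (x \notin X) * (u x - (x == a)) + (a \notin X))%N.
  rewrite (bigD1 a) //= [in RHS](bigD1 a) //= eqxx.
  rewrite (eq_bigr (fun x => (x \notin X) * (u x - (x == a)))%N); last first.
    by move=> x /negPf ->; rewrite subn0.
  by case: (a \notin X) => /=; lia.
have -> : (\sum_x (x \in Y) * v x =
    \sum_x (x \in Y) * (v x - (x == b)) + (b \in Y))%N.
  rewrite (bigD1 b) //= [in RHS](bigD1 b) //= eqxx.
  rewrite (eq_bigr (fun x => (x \in Y) * (v x - (x == b)))%N); last first.
    by move=> x /negPf ->; rewrite subn0.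
  by case: (b \in Y) => /=; lia.
lia.
Qed.

Lemma card_nbrA_D1 F a b x :  (a, b) \notin F ->
  #|nbrA ((a, b) |: F) x| = (#|nbrA F x| + (x == a))%N.
Proof.
move=> abF; case: eqVneq => [->|xa].
  rewrite (_ : nbrA _ a = b |: nbrA F a).
    by rewrite cardsU1 inE abF addnC.
  by apply/setP => y; rewrite !inE xpair_eqE eqxx.
rewrite addn0; apply: eq_card => y.
by rewrite !inE xpair_eqE (negPf xa).
Qed.

Lemma card_nbrB_D1 F a b x :  (a, b) \notin F ->
  #|nbrB ((a, b) |: F) x| = (#|nbrB F x| + (x == b))%N.
Proof.
move=> abF; case: eqVneq => [->|xa].
  rewrite (_ : nbrB _ b = a |: nbrB F b).
    by rewrite cardsU1 inE abF addnC.
  by apply/setP => y; rewrite !inE xpair_eqE eqxx andbT.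
rewrite addn0; apply: eq_card => y.
by rewrite !inE xpair_eqE (negPf xa) andbF.
Qed.

(* Max-flow min-cut for degree-constrained subgraphs.  An edge is either
   superfluous for the minimum cut or can be put into the subgraph: two cuts
   witnessing the contrary would be uncrossed by submodularity. *)
Lemma degree_constrained_subgraph E u v n :
  (forall X Y, n <= cut u v E X Y)%N ->
  exists F, [/\ F \subset E, (n <= #|F|)%N,
    forall a, (#|nbrA F a| <= u a)%N & forall b, (#|nbrB F b| <= v b)%N].
Proof.
have [m] := ubnP #|E|; elim: m => // m IH in E u v n *.
rewrite ltnS => Em hn.
have [E0|[[a b] abE]] := set_0Vmem E.
  exists set0; split; [by rewrite sub0set | | move=> a | move=> b].
  - have := hn setT set0; rewrite /cut E0 big_set0 cards0.
    by rewrite !big1 // => x _; rewrite !inE.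
  - by rewrite (_ : nbrA _ _ = set0) ?cards0 //; apply/setP => y; rewrite !inE.
  - by rewrite (_ : nbrB _ _ = set0) ?cards0 //; apply/setP => y; rewrite !inE.
have cE' : (#|E :\ (a, b)| < m)%N.
  by move: Em; rewrite (cardsD1 (a, b)) abE.
have sE' : E :\ (a, b) \subset E by apply: subD1set.
case: (boolP [forall X, forall Y, n <= cut u v (E :\ (a, b)) X Y]%N).
  move=> /forallP h; have [X Y|F [sF nF uF vF]] := IH _ u v n cE'.
    by move/forallP: (h X).
  by exists F; split=> //; apply: subset_trans sF sE'.
(* This cut drops below [n] when [(a, b)] is removed, so the edge crosses it. *)
move=> /forallPn[X1 /forallPn[Y1]]; rewrite -ltnNge => h1.
have [aX1 bY1] : a \in X1 /\ b \notin Y1.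
  have := hn X1 Y1; rewrite (cut_edge _ _ _ _ abE).
  by case: (a \in X1); case: (b \in Y1) => //=; lia.
(* If [u a] were 0, moving [a] out of [X1] would be free and would take [(a, b)] out of the cut,
   leaving less than [n]; [v b] is treated alike. *)
have ua : (0 < u a)%N.
  rewrite lt0n; apply/negP => /eqP ua0.
  have := hn (X1 :\ a) Y1; rewrite (cut_edge _ _ _ _ abE) !inE eqxx /= addn0.
  apply/negP; rewrite -ltnNge; apply: leq_ltn_trans h1.
  rewrite /cut leq_add // ?leq_add2r.
    apply: leq_sum => x _; rewrite !inE; case: eqVneq => [->|]//=.
    by rewrite ua0 muln0.
  apply: leq_sum => x _; rewrite !inE.
  by case: (x.1 \in X1); rewrite ?andbF // andbT; case: (x.1 == a); case: (x.2 \in Y1).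
have vb : (0 < v b)%N.
  rewrite lt0n; apply/negP => /eqP vb0.
  have := hn X1 (b |: Y1); rewrite (cut_edge _ _ _ _ abE) !inE eqxx /= andbF addn0.
  apply/negP; rewrite -ltnNge; apply: leq_ltn_trans h1.
  rewrite /cut leq_add // ?leq_add2l.
    apply: leq_sum => x _; rewrite !inE; case: eqVneq => [->|]//=.
    by rewrite vb0 muln0.
  apply: leq_sum => x _; rewrite !inE.
  by case: (x.1 \in X1); rewrite ?andbF //; case: (x.2 == b); case: (x.2 \in Y1).
have [X2 Y2|F [sF nF uF vF]] :=
    IH _ (fun x => u x - (x == a))%N (fun x => v x - (x == b))%N n.-1 cE'.
  (* Uncrossing: the intersection and the union both have capacity at least [n] in [E], and the
     corrections from the removed edge and from the lowered capacities add up to 2. *)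
  have hI := hn (X1 :&: X2) (Y1 :&: Y2); have hU := hn (X1 :|: X2) (Y1 :|: Y2).
  have := cut_submodular u v (E :\ (a, b)) X1 Y1 X2 Y2.
  rewrite (cut_decr_cap _ X2 Y2 ua vb).
  move: hI hU; rewrite !(cut_edge _ _ _ _ abE) !inE aX1 (negPf bY1) /=.
  by case: (a \in X2); case: (b \in Y2) => /=; lia.
have abF : (a, b) \notin F.
  by apply/negP => /(subsetP sF); rewrite !inE eqxx.
exists ((a, b) |: F); split=> [|||].
- by rewrite subUset sub1set abE (subset_trans sF sE').
- by rewrite cardsU1 abF; lia.
- move=> x; rewrite card_nbrA_D1 //; have := uF x.
  by case: eqVneq => [->|_] /=; lia.
- move=> x; rewrite card_nbrB_D1 //; have := vF x.
  by case: eqVneq => [->|_] /=; lia.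
Qed.

End Bipartite.

(** * Subgraphs with degrees divisible by a prime *)

Section AlternatingSums.
Local Open Scope ring_scope.
Variables (V : finType) (K : comNzRingType) (D : {set V}).
Implicit Types (I S : {set V}) (w : V -> K).

Definition linear_form w S : K := \sum_(e in S) w e.

(** Adding or removing a fixed element of [D] outside [I] flips the sign and pairs off the sets
    [S]. *)
Lemma alternating_sum_supersets I : I \proper D ->
  \sum_(S : {set V} | (I \subset S) && (S \subset D)) (-1) ^+ #|S| = 0 :> K.
Proof.
move=> /properP[sID [e eD eI]].
rewrite (bigID (fun S => e \in S)) /=.
rewrite (reindex_onto (fun S => e |: S) (fun S => S :\ e)) /=; last first.
  by move=> S /andP[_ eS]; rewrite setD1K.
apply/eqP; rewrite addr_eq0; apply/eqP.
rewrite -sumrN; apply: eq_big => [S|S /andP[_ /eqP eS]].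
  rewrite setU11 andbT; case: (boolP (e \in S)) => eS /=.
    rewrite !andbF; apply/negbTE/nandP; right; apply/eqP => h.
    by move: eS; rewrite -h !inE eqxx.
  rewrite setU1K // eqxx !andbT subUset sub1set eD /=; congr andb.
  apply/subsetP/subsetP => h x xI; last by rewrite inE (h _ xI) orbT.
  by have := h _ xI; rewrite !inE; case: eqVneq => // xe; move: eI; rewrite -xe xI.
have eS' : e \notin S by rewrite -eS !inE eqxx.
by rewrite cardsU1 eS' exprS mulN1r.
Qed.

(** Expanding one linear form leaves, for each [e], a sum over those [S] that also contain [e]: one
    form is traded for at most one new element of [I]. *)
Lemma alternating_sum_low_degree (ls : seq (V -> K)) I :
  I \subset D -> (#|I| + size ls < #|D|)%N ->
  \sum_(S : {set V} | (I \subset S) && (S \subset D))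
     (-1) ^+ #|S| * \prod_(w <- ls) linear_form w S = 0.
Proof.
elim: ls I => [|w ls IH] I sID /= hI.
  under eq_bigr => S _ do rewrite big_nil mulr1.
  by apply: alternating_sum_supersets; rewrite properEcard sID; lia.
under eq_bigr => S _.
  rewrite big_cons mulrCA /linear_form mulr_suml.
  over.
rewrite /= (eq_bigr (fun S : {set V} => \sum_(e in D)
  (if e \in S then w e * ((-1) ^+ #|S| * \prod_(w <- ls) linear_form w S) else 0)));
  last first.
  move=> S /andP[_ SD]; rewrite -big_mkcondr /=; apply: eq_bigl => e.
  by case eS: (e \in S); rewrite ?andbF //= andbT (subsetP SD).
rewrite exchange_big big1 //= => e eD.
rewrite -big_mkcondr /= -mulr_sumr.
rewrite (eq_bigl (fun S : {set V} => (e |: I \subset S) && (S \subset D))); last first.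
  by move=> S; rewrite subUset sub1set; case: (e \in S); case: (I \subset S); case: (_ \subset D).
rewrite IH ?mulr0 // ?subUset ?sub1set ?eD // cardsU1.
by case: (e \notin I) => /=; lia.
Qed.

(** Splitting one factor [1 - linear_form w S ^+ n] gives two sums with fewer such factors, the
    second with [n] more plain forms, which [ls] collects. *)
Lemma alternating_sum_product n (ws ls : seq (V -> K)) I :
  I \subset D -> (#|I| + size ls + n * size ws < #|D|)%N ->
  \sum_(S : {set V} | (I \subset S) && (S \subset D))
     (-1) ^+ #|S| * \prod_(w <- ls) linear_form w S
       * \prod_(w <- ws) (1 - linear_form w S ^+ n) = 0.
Proof.
elim: ws ls => [|w ws IH] ls sID /= hI.
  under eq_bigr => S _ do rewrite big_nil mulr1.
  by apply: alternating_sum_low_degree; lia.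
have h1 := IH ls sID; have h2 := IH (nseq n w ++ ls) sID.
rewrite size_cat size_nseq in h2.
have {}h1 := h1 ltac:(lia).
have {}h2 := h2 ltac:(lia).
rewrite (eq_bigr (fun S => (-1) ^+ #|S| * \prod_(w <- ls) linear_form w S
       * \prod_(w <- ws) (1 - linear_form w S ^+ n) -
   (-1) ^+ #|S| * \prod_(w <- nseq n w ++ ls) linear_form w S
       * \prod_(w <- ws) (1 - linear_form w S ^+ n))).
  by rewrite sumrB h1 h2 subrr.
move=> S _; rewrite big_cons big_cat /= big_nseq iter_mulr_1.
by rewrite mulrBl mulrBr mul1r; congr (_ - _); rewrite !mulrA; congr (_ * _); rewrite mulrAC.
Qed.

End AlternatingSums.

Section Olson.
Variables A B : finType.
Implicit Types (F : {set A * B}) (X : {set A}) (Y : {set B}).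
Local Open Scope ring_scope.

(* Alon, Friedland and Kalai: if only the empty subset had all its degrees
   divisible by q, the alternating sum over all subsets of F of the indicator
   of this property, a polynomial of degree less than #|F|, would be 1. *)
Lemma degrees_divisible_by_prime q F X Y : prime q -> F \subset setX X Y ->
  (q.-1 * (#|X| + #|Y|) < #|F|)%N ->
  exists F', [/\ F' \subset F, F' != set0,
    forall a, (q %| #|nbrA F' a|)%N & forall b, (q %| #|nbrB F' b|)%N].
Proof.
move=> q_pr sF hF.
(* These forms evaluate at [S] to its degrees modulo [q], and [1 - x ^+ q.-1] is the indicator of
   [x = 0] in ['F_q]. *)
pose ws : seq (A * B -> 'F_q) :=
  [seq (fun e => (e.1 == a)%:R) | a <- enum X] ++
  [seq (fun e => (e.2 == b)%:R) | b <- enum Y].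
have LA a (S : {set A * B}) :
    linear_form (fun e => (e.1 == a)%:R : 'F_q) S = #|nbrA S a|%:R.
  rewrite /linear_form -natr_sum; congr _%:R.
  rewrite -big_mkcondr /= sum1_card.
  have inj : injective (pair a : B -> A * B) by move=> b b' [].
  rewrite -(card_imset (nbrA S a) inj).
  apply: eq_card => -[a' b] /=; apply/andP/imsetP => [[h /eqP/= <-]|[b1 hb [-> ->]]].
    by exists b; rewrite ?inE.
  by rewrite in_set in hb.
have LB b (S : {set A * B}) :
    linear_form (fun e => (e.2 == b)%:R : 'F_q) S = #|nbrB S b|%:R.
  rewrite /linear_form -natr_sum; congr _%:R.
  rewrite -big_mkcondr /= sum1_card.
  have inj : injective (pair^~ b : A -> A * B) by move=> a a' [].
  rewrite -(card_imset (nbrB S b) inj).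
  apply: eq_card => -[a b'] /=; apply/andP/imsetP => [[h /eqP/= <-]|[a1 ha [-> ->]]].
    by exists a; rewrite ?inE.
  by rewrite in_set in ha.
have zero_mod n : (n%:R == 0 :> 'F_q) = (q %| n)%N.
  by rewrite (dvdn_pcharf (pchar_Fp q_pr)).
have killed (x : 'F_q) : x != 0 -> 1 - x ^+ q.-1 = 0.
  move=> x0; have := expf_card x; rewrite card_Fp // => xq.
  have /(mulfI x0) -> : x * x ^+ q.-1 = x * 1; last by rewrite subrr.
  by rewrite -exprS (prednK (prime_gt0 q_pr)) mulr1.
have := @alternating_sum_product _ _ F q.-1 ws [::] set0 (sub0set _).
rewrite cards0 /= add0n size_cat !size_map -!cardE add0n => /(_ hF) h0.
case: (boolP [exists F' : {set A * B}, [&& F' \subset F, F' != set0,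
    [forall a, q %| #|nbrA F' a|] & [forall b, q %| #|nbrB F' b|]]])%N.
  move=> /existsP[F' /and4P[? ? /forallP ? /forallP ?]].
  by exists F'.
(* Every non-empty [S] has a degree not divisible by [q], so its product vanishes; the term of
   [set0] alone survives and equals 1. *)
move=> /existsPn hn; move: h0.
rewrite (bigD1 set0) /=; last by rewrite !sub0set.
rewrite [X in _ + X]big1 ?addr0; last first.
  move=> S /andP[/andP[_ SF] S0]; apply/eqP; rewrite mulf_eq0; apply/orP; right.
  have := hn S; rewrite SF S0 /= negb_and => /orP[]/forallPn[v hv].
    have vX : v \in X.
      have: nbrA S v != set0.
        by apply: contraNneq hv => ->; rewrite cards0 dvdn0.
      by case/set0Pn => b; rewrite inE => /(subsetP SF) /(subsetP sF); rewrite inE => /andP[].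
    rewrite big_cat mulf_eq0 !big_map /= prodf_seq_eq0; apply/orP; left; apply/hasP.
    by exists v; rewrite ?mem_enum //= LA killed ?zero_mod.
  have vY : v \in Y.
    have: nbrB S v != set0.
      by apply: contraNneq hv => ->; rewrite cards0 dvdn0.
    by case/set0Pn => a; rewrite inE => /(subsetP SF) /(subsetP sF); rewrite inE => /andP[].
  rewrite big_cat mulf_eq0 !big_map /= [X in _ || X]prodf_seq_eq0.
  apply/orP; right; apply/hasP.
  by exists v; rewrite ?mem_enum //= LB killed ?zero_mod.
rewrite cards0 expr0 big_nil !mul1r big1; first by move/eqP; rewrite oner_eq0.
move=> w _; rewrite /linear_form big_set0 expr0n.
by case: (q) q_pr => [|[|?]] //= _; rewrite subr0.
Qed.

End Olson.

(** * From nearly regular to regular bipartite graphs *)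

Section Finish.
Variables A B : finType.
Implicit Types (E F : {set A * B}) (X : {set A}) (Y : {set B}).

Lemma nbrA_sub F F' a : F' \subset F -> nbrA F' a \subset nbrA F a.
Proof. by move=> sF; apply/subsetP => b; rewrite !inE; apply: (subsetP sF). Qed.

Lemma nbrB_sub F F' b : F' \subset F -> nbrB F' b \subset nbrB F b.
Proof. by move=> sF; apply/subsetP => a; rewrite !inE; apply: (subsetP sF). Qed.

Lemma multiple_below_double q n : (0 < n)%N -> (n <= q.*2.-1)%N -> (q %| n)%N -> n = q.
Proof. by move=> n0 nq /dvdnP[[|[|m]] E]; nia. Qed.

(** A positive multiple of [q] that is at most [2 q - 1] is [q] itself. *)
Lemma dense_bounded_degree_biregular q F X Y : prime q -> F \subset setX X Y ->
  (q.-1 * (#|X| + #|Y|) < #|F|)%N ->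
  (forall a, #|nbrA F a| <= q.*2.-1)%N -> (forall b, #|nbrB F b| <= q.*2.-1)%N ->
  exists2 F' : {set A * B}, F' \subset F & biregular q F'.
Proof.
move=> q_pr sF hF hA hB.
have [F' [sF' F'0 dA dB]] := degrees_divisible_by_prime q_pr sF hF.
exists F' => //; split=> // a b abF; split; apply: multiple_below_double => //.
- by apply/card_gt0P; exists b; rewrite inE.
- by apply: leq_trans (hA a); apply/subset_leq_card/nbrA_sub.
- by apply/card_gt0P; exists a; rewrite inE.
- by apply: leq_trans (hB b); apply/subset_leq_card/nbrB_sub.
Qed.

Lemma card_edgesA_in E X Y : E \subset setX X Y -> #|E| = \sum_(a in X) #|nbrA E a|.
Proof.
move=> sE; rewrite card_edgesA [RHS]big_mkcond /=; apply: eq_bigr => a _.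
case: ifPn => // aX; apply/eqP; rewrite cards_eq0; apply/eqP/setP => b.
rewrite !inE; apply: contraNF aX => /(subsetP sE).
by rewrite inE => /andP[].
Qed.

Lemma card_edgesB_in E X Y : E \subset setX X Y -> #|E| = \sum_(b in Y) #|nbrB E b|.
Proof.
move=> sE; rewrite card_edgesB [RHS]big_mkcond /=; apply: eq_bigr => b _.
case: ifPn => // bY; apply/eqP; rewrite cards_eq0; apply/eqP/setP => a.
rewrite !inE; apply: contraNF bY => /(subsetP sE).
by rewrite inE => /andP[].
Qed.

(* The constant fractional weight m / t on edges meets every cut. *)
Lemma cut_fractional F X Y m t (u := fun a => m * (a \in X)) (v := fun b => m * (b \in Y)) X1 Y1 :
  F \subset setX X Y -> (m <= t)%N -> (forall a, #|nbrA F a| <= t)%N ->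
  (m * \sum_(b in Y) minn #|nbrB F b| t <= t * cut u v F X1 Y1)%N.
Proof.
move=> sF mt dA.
have h1 : (\sum_(b in Y) minn #|nbrB F b| t <=
   \sum_b (b \in Y1) * (t * (b \in Y)) + #|[set e in F | e.2 \notin Y1]|)%N.
  rewrite card_edgesB big_mkcond /= -big_split /=; apply: leq_sum => b _.
  case: ifP => // bY; case: (boolP (b \in Y1)) => bY1; first by rewrite muln1 mul1n; lia.
  rewrite mul0n add0n (leq_trans (geq_minl _ _)) // subset_leq_card //.
  by apply/subsetP => a; rewrite !inE /= => ->.
have h2 : (#|[set e in F | e.2 \notin Y1]| <=
   \sum_a (a \notin X1) * (t * (a \in X)) +
   \sum_(e in F) (e.1 \in X1) && (e.2 \notin Y1))%N.
  have -> : (\sum_(e in F) (e.1 \in X1) && (e.2 \notin Y1))%N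
      = #|[set e in F | (e.1 \in X1) && (e.2 \notin Y1)]|.
    rewrite -sum1_card big_mkcond [RHS]big_mkcond /=; apply: eq_bigr => e _.
    by rewrite inE; case: (e \in F) => //=; case: (_ && _).
  rewrite !card_edgesA -big_split /=; apply: leq_sum => a _.
  case: (boolP (a \in X1)) => aX1 /=.
    rewrite mul0n add0n subset_leq_card //.
    by apply/subsetP => b; rewrite !inE /= aX1 => ->.
  rewrite mul1n; case: (boolP (a \in X)) => aX.
    rewrite muln1 (leq_trans _ (leq_addr _ _)) // (leq_trans _ (dA a)) //.
    by apply/subset_leq_card/subsetP => b; rewrite !inE => /andP[].
  rewrite (_ : nbrA [set e in F | e.2 \notin Y1] a = set0) ?cards0 //; apply/setP => b; rewrite !inE.
  by apply: contraNF aX => /andP[/(subsetP sF)]; rewrite inE => /andP[].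
rewrite /cut /u /v.
have sumA : (\sum_a (a \notin X1) * (t * (a \in X)) = t * \sum_a (a \notin X1) * (a \in X))%N.
  by rewrite big_distrr; apply: eq_bigr => a _; rewrite /= mulnCA.
have sumA' : (\sum_a (a \notin X1) * (m * (a \in X)) = m * \sum_a (a \notin X1) * (a \in X))%N.
  by rewrite big_distrr; apply: eq_bigr => a _; rewrite /= mulnCA.
have sumB : (\sum_b (b \in Y1) * (t * (b \in Y)) = t * \sum_b (b \in Y1) * (b \in Y))%N.
  by rewrite big_distrr; apply: eq_bigr => a _; rewrite /= mulnCA.
have sumB' : (\sum_b (b \in Y1) * (m * (b \in Y)) = m * \sum_b (b \in Y1) * (b \in Y))%N.
  by rewrite big_distrr; apply: eq_bigr => a _; rewrite /= mulnCA.
rewrite sumB in h1; rewrite sumA in h2; rewrite sumA' sumB'.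
set S := (\sum_(b in Y) _)%N in h1 *; set P := (\sum_a _ * _)%N in h2 *.
set Q := (\sum_b _ * _)%N in h1 *; set W := (\sum_(e in F) _)%N in h2 *.
have h3 : (S <= t * Q + t * P + W)%N by lia.
have : (m * S <= m * (t * Q + t * P + W))%N by rewrite leq_mul2l h3 orbT.
have : (m * W <= t * W)%N by rewrite leq_mul2r mt orbT.
by move=> *; nia.
Qed.

(** Max-flow min-cut turns the fractional weight [m / t] into an actual subgraph. *)
Lemma bounded_degree_subgraph F X Y m t n : F \subset setX X Y -> (0 < m <= t)%N ->
  (forall a, #|nbrA F a| <= t)%N ->
  (t * n < m * \sum_(b in Y) minn #|nbrB F b| t)%N ->
  exists F', [/\ F' \subset F, (n < #|F'|)%N,
    forall a, (#|nbrA F' a| <= m)%N & forall b, (#|nbrB F' b| <= m)%N].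
Proof.
move=> sF /andP[m0 mt] dA hn.
have [X1 Y1|F' [sF' cF' uF vF]] := @degree_constrained_subgraph _ _ F
  (fun a => m * (a \in X))%N (fun b => m * (b \in Y))%N n.+1.
  have := cut_fractional X1 Y1 sF mt dA => /(leq_trans hn).
  by rewrite ltn_pmul2l //; lia.
by exists F'; split=> // x; [apply: leq_trans (uF x) _|apply: leq_trans (vF x) _];
  rewrite -[leqRHS]muln1 leq_mul2l leq_b1 orbT.
Qed.

(** Capping all degrees by [2 q - 1] leaves more than [q - 1] edges per vertex. *)
Lemma nearly_regular_biregular q F X Y t : prime q -> F \subset setX X Y ->
  (q.*2.-1 <= t)%N -> (forall a, #|nbrA F a| <= t)%N ->
  (t * (q.-1 * (#|X| + #|Y|)) < q.*2.-1 * \sum_(b in Y) minn #|nbrB F b| t)%N ->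
  exists2 F' : {set A * B}, F' \subset F & biregular q F'.
Proof.
move=> q_pr sF qt dA hF; have q1 := prime_gt1 q_pr.
have qt' : (0 < q.*2.-1 <= t)%N by rewrite qt andbT; lia.
have [F' [sF' cF' uF vF]] := bounded_degree_subgraph sF qt' dA hF.
have [F2 s2 r2] := dense_bounded_degree_biregular q_pr (subset_trans sF' sF) cF' uF vF.
by exists F2 => //; apply: subset_trans s2 sF'.
Qed.

(** The weight [k / q] has total [k * #|X|], and both sides have equal size; a subgraph with that
    many edges and degrees at most [k] has all its degrees equal to [k]. *)
Lemma biregular_lower k q F : (0 < k <= q)%N -> biregular q F ->
  exists2 F' : {set A * B}, F' \subset F & biregular k F'.
Proof.
move=> /andP[k0 kq] [F0 rF].
pose X := [set e.1 | e in F]; pose Y := [set e.2 | e in F].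
have sF : F \subset setX X Y.
  by apply/subsetP => e eF; rewrite inE !imset_f.
have dA a : a \in X -> #|nbrA F a| = q.
  by move=> /imsetP[[a1 b] /rF[h _] ->].
have dB b : b \in Y -> #|nbrB F b| = q.
  by move=> /imsetP[[a b1] /rF[_ h] ->].
have cX : #|F| = (q * #|X|)%N.
  by rewrite (card_edgesA_in sF) (eq_bigr _ dA) sum_nat_const mulnC.
have cY : #|F| = (q * #|Y|)%N.
  by rewrite (card_edgesB_in sF) (eq_bigr _ dB) sum_nat_const mulnC.
have q0 : (0 < q)%N by lia.
have XY : #|X| = #|Y| by apply/eqP; rewrite -(eqn_pmul2l q0) -cX cY.
have F1 : (0 < #|F|)%N by rewrite card_gt0.
have leA a : (#|nbrA F a| <= q)%N.
  case: (boolP (a \in X)) => [/dA -> //|aX].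
  have -> : nbrA F a = set0; last by rewrite cards0.
  apply/setP => b; rewrite !inE; apply: contraNF aX => /(subsetP sF).
  by rewrite inE => /andP[].
have X0 : (0 < #|X|)%N by case: #|X| cX => [|//]; lia.
have [||F' [sF' cF' uF vF]] := @bounded_degree_subgraph F X Y k q (k * #|X|).-1 sF _ leA.
- by rewrite k0.
- rewrite (eq_bigr (fun=> q)); last by move=> b /dB ->; rewrite minnn.
  rewrite sum_nat_const -XY mulnCA mulnC mulnA [(#|X| * k)%N]mulnC mulnC.
  by rewrite [ltnRHS]mulnC ltn_pmul2l // prednK // muln_gt0 k0.
have sF2 := subset_trans sF' sF.
have full (T : finType) (Z : {set T}) (g : T -> nat) : (forall x, g x <= k)%N ->
    (k * #|Z| <= \sum_(x in Z) g x)%N -> forall x, x \in Z -> g x = k.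
  move=> gk hZ x xZ; apply/eqP; rewrite eqn_leq gk /=.
  move: hZ; rewrite (big_setD1 x xZ) /= (cardsD1 x Z) xZ mulnDr muln1.
  have : (\sum_(y in Z :\ x) g y <= k * #|Z :\ x|)%N.
    by rewrite mulnC -sum_nat_const; apply: leq_sum.
  lia.
have kX : (k * #|X| <= #|F'|)%N by lia.
exists F' => //; split.
  by rewrite -card_gt0; apply: leq_trans kX; rewrite muln_gt0 k0.
move=> a b abF'; have abXY := subsetP sF2 _ abF'.
rewrite inE in abXY; case/andP: abXY => /= aX bY; split.
  by apply: (full _ X (fun a => #|nbrA F' a|)) => //; rewrite -(card_edgesA_in sF2).
by apply: (full _ Y (fun b => #|nbrB F' b|)) => //; rewrite -(card_edgesB_in sF2) -XY.
Qed.

End Finish.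

(** * Random sampling *)

Section ProductMeasure.
Local Open Scope ring_scope.
Variables (V : finType) (K : realFieldType) (pr : V -> K).
Implicit Types (S U : {set V}) (f : {set V} -> K).

Definition weight S : K := \prod_v (if v \in S then pr v else 1 - pr v).

Definition expect f := \sum_S weight S * f S.

(** Distributing the product of [pr v + (1 - pr v)], with the second summand dropped for [v] in [U],
    leaves the weights of the sets containing [U]. *)
Lemma expect_subset U : expect (fun S => (U \subset S)%:R) = \prod_(v in U) pr v.
Proof.
have -> : \prod_(v in U) pr v = \prod_v (pr v + (if v \in U then 0 else 1 - pr v)).
  rewrite big_mkcond; apply: eq_bigr => v _.
  by case: ifP; rewrite ?addr0 // addrC subrK.
rewrite bigA_distr /expect /=; apply: eq_bigr => S _.
rewrite /weight; case: (boolP (U \subset S)) => [sUS|/subsetPn[v vU vS]].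
  rewrite mulr1; apply: eq_bigr => v _; case: ifPn => // vS.
  by rewrite ifN //; apply: contra vS => /(subsetP sUS).
by rewrite mulr0 (bigD1 v) //= (negPf vS) vU mul0r.
Qed.

Lemma expectD f g : expect (fun S => f S + g S) = expect f + expect g.
Proof. by rewrite -big_split; apply: eq_bigr => S _; rewrite mulrDr. Qed.

Lemma expectZ x f : expect (fun S => x * f S) = x * expect f.
Proof. by rewrite /expect mulr_sumr; apply: eq_bigr => S _; rewrite mulrCA. Qed.

Lemma expectB f g : expect (fun S => f S - g S) = expect f - expect g.
Proof. by rewrite -sumrB; apply: eq_bigr => S _; rewrite mulrBr. Qed.

Lemma expect_sum (I : finType) (P : pred I) (g : I -> {set V} -> K) :
  expect (fun S => \sum_(i | P i) g i S) = \sum_(i | P i) expect (g i).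
Proof.
rewrite /expect exchange_big /=; apply: eq_bigr => S _.
by rewrite mulr_sumr.
Qed.

Lemma eq_expect f g : f =1 g -> expect f = expect g.
Proof. by move=> fg; apply: eq_bigr => S _; rewrite fg. Qed.

Lemma expect_gt0 f : (forall v, 0 <= pr v <= 1) -> 0 < expect f -> exists S, 0 < f S.
Proof.
move=> pr01 f_gt0; apply/existsP; apply: contraTT f_gt0 => /existsPn fn.
rewrite -leNgt; apply: sumr_le0 => S _; rewrite mulr_ge0_le0 //; last by rewrite leNgt.
apply: prodr_ge0 => v _; have /andP[p0 p1] := pr01 v.
by case: ifP; rewrite // subr_ge0.
Qed.

End ProductMeasure.

Section Sampling.
Local Open Scope ring_scope.
Variables (A B : finType) (K : realFieldType).
Variables (F : {set A * B}) (X : {set A}) (Y : {set B}).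
Variables (p c : K) (beta : B -> K) (t : nat).

Hypothesis sF : F \subset setX X Y.
Hypothesis p_gt0 : 0 < p.
Hypothesis c_gt0 : 0 < c.
Hypothesis beta_gt0 : forall b, 0 < beta b.
Hypothesis beta_le1 : forall b, beta b <= 1.
Hypothesis p_le : forall a, p <= \prod_(b in nbrA F a) beta b.
Hypothesis load_le : forall b, p * #|nbrB F b|%:R <= (t%:R - c) * beta b.

(* Keep b with probability beta b, and keep a if all its neighbours are kept
   and an independent coin of bias p / prod beta succeeds: then every a is kept
   with probability p, and a kept b has expected degree p * deg b / beta b. *)
Let pr (v : A + B) : K :=
  match v with inl a => p / \prod_(b in nbrA F a) beta b | inr b => beta b end.

(** What has to be kept for [a] to survive: its own coin and all its neighbours. *)
Let U a : {set A + B} :=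
  [set v : A + B | match v with inl x => x == a | inr b => b \in nbrA F a end].

Let prod_gt0 (Z : {set B}) : 0 < \prod_(b in Z) beta b.
Proof. by apply: prodr_gt0 => b _. Qed.

Let pr01 v : 0 <= pr v <= 1.
Proof.
case: v => [a|b] /=; last by rewrite (ltW (beta_gt0 b)) beta_le1.
by rewrite ler_pdivrMr ?mul1r ?p_le // divr_ge0 ?ltW.
Qed.

Let alpha (S : {set A + B}) a : K := (U a \subset S)%:R.

Lemma expect_alpha a : expect pr (alpha^~ a) = p.
Proof.
rewrite /alpha expect_subset big_sumType /=.
rewrite (eq_bigl (pred1 a)); last by move=> x; rewrite inE.
rewrite big_pred1_eq [X in _ * X](eq_bigl (mem (nbrA F a))); last by move=> b; rewrite !inE.
by rewrite /pr /= divfK // gt_eqF.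
Qed.

(** Joint survival probability of distinct [a] and [a']: a common neighbour is needed by both but
    paid for only once. *)
Definition pair_prob a a' := p ^+ 2 / \prod_(b in nbrA F a :&: nbrA F a') beta b.

Lemma expect_alpha2 a a' : a' != a ->
  expect pr (fun S => alpha S a * alpha S a') = pair_prob a a'.
Proof.
move=> aa'.
rewrite (@eq_expect _ _ pr _ (fun S => (U a :|: U a' \subset S)%:R)); last first.
  by move=> S; rewrite /alpha -natrM mulnb subUset.
rewrite expect_subset big_sumType /=.
rewrite (bigD1 a) /=; last by rewrite !inE eqxx.
rewrite (big_pred1 a'); last first.
  by move=> x; rewrite /= !inE; case: eqVneq => [->|]; rewrite ?andbF ?andbT //= eq_sym (negPf aa').
rewrite [X in _ * X](eq_bigl (mem (nbrA F a :|: nbrA F a'))); last by move=> b; rewrite !inE.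
have UI : (\prod_(b in nbrA F a :|: nbrA F a') beta b) *
    (\prod_(b in nbrA F a :&: nbrA F a') beta b) =
    (\prod_(b in nbrA F a) beta b) * (\prod_(b in nbrA F a') beta b).
  rewrite ![\prod_(b in _) _]big_mkcond /= -!big_split; apply: eq_bigr => b _ /=.
  by rewrite !inE; case: (_ \in F); case: (_ \in F); rewrite /= ?mulr1 ?mul1r.
rewrite /pair_prob /pr /=; move: UI.
have x0 := prod_gt0 (nbrA F a); have y0 := prod_gt0 (nbrA F a').
have z0 := prod_gt0 (nbrA F a :&: nbrA F a').
set x := \prod_(b in nbrA F a) beta b in x0 *.
set y := \prod_(b in nbrA F a') beta b in y0 *.
set z := \prod_(b in _ :&: _) beta b in z0 *.
set w := \prod_(b in _ :|: _) beta b => UI.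
apply: (@mulIf _ z); first by rewrite gt_eqF.
rewrite divfK ?gt_eqF // -[LHS]mulrA UI.
by field; rewrite !gt_eqF.
Qed.

Let deg S b : K := \sum_(a in nbrB F b) alpha S a.
Let gamma (S : {set A + B}) b : K := (inr b \in S)%:R.
(** Mean degree of [b] given that [b] is kept; [load_le] leaves room [c] between it and the
    truncation at [t]. *)
Let l b : K := p * #|nbrB F b|%:R / beta b.

Lemma expect_gamma b : expect pr (gamma^~ b) = beta b.
Proof.
rewrite (@eq_expect _ _ pr _ (fun S => ([set inr b] \subset S)%:R)); last first.
  by move=> S; rewrite sub1set.
by rewrite expect_subset big_set1.
Qed.

Lemma expect_deg b : expect pr (deg^~ b) = p * #|nbrB F b|%:R.
Proof.
rewrite expect_sum (eq_bigr (fun=> p)); last by move=> a _; apply: expect_alpha.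
by rewrite sumr_const mulr_natr.
Qed.

(** Second-moment surplus over the case in which [b] is the only common neighbour of any two of its
    neighbours. *)
Definition excess b := \sum_(a in nbrB F b) \sum_(a' in nbrB F b | a' != a)
  (pair_prob a a' - p ^+ 2 / beta b).

Lemma expect_deg2 b : expect pr (fun S => deg S b ^+ 2) =
  p * #|nbrB F b|%:R + excess b +
  #|nbrB F b|%:R * (#|nbrB F b|%:R - 1) * (p ^+ 2 / beta b).
Proof.
rewrite (@eq_expect _ _ pr _ (fun S => \sum_(a in nbrB F b)
    (alpha S a + \sum_(a' in nbrB F b | a' != a) alpha S a * alpha S a'))); last first.
  move=> S; rewrite expr2 {1}/deg mulr_suml; apply: eq_bigr => a ab.
  rewrite /deg mulr_sumr (bigD1 a) //=; congr (_ + _).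
  by rewrite /alpha -natrM mulnb andbb.
rewrite expect_sum.
rewrite (eq_bigr (fun a => (p + \sum_(a' in nbrB F b | a' != a)
   (pair_prob a a' - p ^+ 2 / beta b)) + (#|nbrB F b|%:R - 1) * (p ^+ 2 / beta b))).
  rewrite !big_split /= !sumr_const -/(excess b) mulr_natr; congr (_ + _ + _).
  by rewrite -[LHS]mulr_natl mulrA.
move=> a ab; rewrite expectD expect_alpha expect_sum -addrA; congr (_ + _).
rewrite (eq_bigr (fun a' => (pair_prob a a' - p ^+ 2 / beta b) + p ^+ 2 / beta b)).
  rewrite big_split /= sumr_const; congr (_ + _).
  rewrite (cardsD1 a (nbrB F b)) ab natrD addrAC subrr add0r mulr_natl; congr (_ *+ _).
  by apply: eq_card => x; rewrite !inE unfold_in /= !inE andbC.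
by move=> a' /andP[_ aa']; rewrite expect_alpha2 // subrK.
Qed.

(** Equals [(deg S b - l b) ^+ 2] if [b] is kept and 0 otherwise, since then [deg S b] is 0; written
    as a combination of terms with known expectation. *)
Let dev S b := deg S b ^+ 2 - 2 * l b * deg S b + l b ^+ 2 * gamma S b.

Lemma expect_dev b : expect pr (dev^~ b) <= p * #|nbrB F b|%:R + excess b.
Proof.
rewrite expectD expectB !expectZ expect_deg2 expect_deg expect_gamma /l.
have b0 := beta_gt0 b; move: (excess b) => x.
have d0 : 0 <= #|nbrB F b|%:R :> K by [].
rewrite -subr_ge0 (_ : _ - _ = p ^+ 2 / beta b * #|nbrB F b|%:R).
  by rewrite mulr_ge0 // divr_ge0 ?sqr_ge0 // ltW.
by field; rewrite gt_eqF.
Qed.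

Let F' (S : {set A + B}) := [set e in F | U e.1 \subset S].

Lemma degE S b : deg S b = #|nbrB (F' S) b|%:R.
Proof.
rewrite /deg /alpha -natr_sum -big_mkcondr sum1_card; congr _%:R.
by apply: eq_card => a; rewrite !inE unfold_in /= !inE.
Qed.

(** For [D > t] and [m <= t - c], the bound [D - (D - m) ^ 2 / (4 c) <= t] follows from
    [(D - m - 2 c) ^ 2 >= 0]: the deviation pays for the truncation. *)
Lemma truncated_deg S b :
  deg S b - dev S b / (4 * c) <= gamma S b * (minn #|nbrB (F' S) b| t)%:R.
Proof.
rewrite /dev /gamma; case: (boolP (inr b \in S)) => bS; last first.
  rewrite degE (_ : nbrB _ _ = set0) ?cards0.
    by rewrite mul0r mulr0 expr0n /= !mulr0 !subr0 addr0 mul0r subr0.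
  apply/setP => a; rewrite !inE; apply: contraNF bS => /andP[abF /subsetP].
  by apply; rewrite !inE.
rewrite mul1r mulr1.
have lt : l b <= t%:R - c by rewrite /l ler_pdivrMr // load_le.
have [tD|tD] := leqP #|nbrB (F' S) b| t.
  have sq : deg S b ^+ 2 - 2 * l b * deg S b + l b ^+ 2 = (deg S b - l b) ^+ 2 by ring.
  by rewrite -degE sq lerBlDr lerDl divr_ge0 ?sqr_ge0 ?mulr_ge0 ?ltW.
have {tD} : t%:R < deg S b by rewrite degE ltr_nat.
move: (deg S b) (l b) (t%:R : K) lt => D m T lt TD.
have h1 : 0 <= c * (T - c - m) by rewrite mulr_ge0 ?(ltW c_gt0) // -addrA -opprD subr_ge0 addrC -lerBrDr.
have h2 := sqr_ge0 (D - m - 2 * c).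
rewrite lerBlDl -lerBlDr ler_pdivlMr ?mulr_gt0 // -subr_ge0.
by rewrite [leRHS](_ : _ = (D - m - 2 * c) ^+ 2 + 4 * (c * (T - c - m))); [lra | ring].
Qed.

Lemma sampling (mu : K) :
  \sum_(b in Y) excess b <= p * #|F|%:R ->
  mu * (p * #|X|%:R + \sum_(b in Y) beta b) < p * #|F|%:R * (1 - (2 * c)^-1) ->
  exists (X' : {set A}) (Y' : {set B}) (F1 : {set A * B}),
    [/\ F1 \subset F, F1 \subset setX X' Y' &
    mu * (#|X'| + #|Y'|)%:R < (\sum_(b in Y') minn #|nbrB F1 b| t)%:R].
Proof.
move=> hexc hmu.
pose Phi S := \sum_(b in Y) (deg S b - (4 * c)^-1 * dev S b) -
   mu * (\sum_(a in X) alpha S a + \sum_(b in Y) gamma S b).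
have cF : \sum_(b in Y) p * #|nbrB F b|%:R = p * #|F|%:R.
  by rewrite (card_edgesB_in sF) natr_sum mulr_sumr.
have PhiE : 0 < expect pr Phi.
  rewrite expectB expectZ expectD !expect_sum subr_gt0.
  rewrite [X in mu * (X + _)](eq_bigr (fun=> p)); last by move=> a _; apply: expect_alpha.
  rewrite [X in mu * (_ + X)](eq_bigr beta); last by move=> b _; apply: expect_gamma.
  rewrite sumr_const -[p *+ _]mulr_natr; apply: lt_le_trans hmu _.
  apply: (@le_trans _ _ (\sum_(b in Y) (p * #|nbrB F b|%:R -
     (4 * c)^-1 * (p * #|nbrB F b|%:R + excess b)))).
    rewrite sumrB cF -mulr_sumr big_split /= cF.
    have c4 : 0 < (4 * c)^-1 by rewrite invr_gt0 mulr_gt0.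
    (* One share pays for the main term of [expect_dev], the other for the excess. *)
    have -> : (2 * c)^-1 = (4 * c)^-1 + (4 * c)^-1 by field; rewrite gt_eqF.
    move: ((4 * c)^-1) c4 hexc => x x0; move: (p * _) (\sum_(b in Y) _) => y z zy.
    nra.
  apply: ler_sum => b _; rewrite expectB expectZ expect_deg lerD2l lerN2.
  by rewrite ler_pM2l ?invr_gt0 ?mulr_gt0 // expect_dev.
have [S] := expect_gt0 pr01 PhiE; rewrite subr_gt0 => hS.
exists [set a in X | U a \subset S], [set b in Y | inr b \in S], (F' S); split.
- by apply/subsetP => e; rewrite inE => /andP[].
- apply/subsetP => -[a b]; rewrite !inE /= => /andP[abF US].
  have := subsetP sF _ abF; rewrite inE /= => /andP[-> ->].
  by rewrite US (subsetP US) // !inE.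
have -> : (#|[set a in X | U a \subset S]| + #|[set b in Y | inr b \in S]|)%:R =
    \sum_(a in X) alpha S a + \sum_(b in Y) gamma S b.
  rewrite natrD -!sum1_card !natr_sum; congr (_ + _).
    rewrite big_mkcond [RHS]big_mkcond /=; apply: eq_bigr => a _.
    by rewrite !inE /alpha; case: (_ \in X); case: (_ \subset S).
  rewrite big_mkcond [RHS]big_mkcond /=; apply: eq_bigr => a _.
  by rewrite !inE /gamma; case: (_ \in Y); case: (_ \in S).
apply: lt_le_trans hS _; rewrite natr_sum.
have -> : \sum_(b in [set b in Y | inr b \in S]) (minn #|nbrB (F' S) b| t)%:R =
   \sum_(b in Y) gamma S b * (minn #|nbrB (F' S) b| t)%:R.
  rewrite big_mkcond [RHS]big_mkcond /=; apply: eq_bigr => b _.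
  by rewrite !inE /gamma; case: (_ \in Y); case: (_ \in S) => //=; rewrite ?mul0r ?mul1r.
by apply: ler_sum => b _; rewrite mulrC truncated_deg.
Qed.

End Sampling.

(** * Regular subgraphs obtained by sampling *)

Lemma double_lt_threshold q t : prime q -> t = (16 * q ^ 2)%N -> (2 * q < t)%N.
Proof. by move=> /prime_gt1 ? ?; nia. Qed.

Section SampledBiregular.
Variables (A B : finType) (K : realFieldType) (q : nat).
Hypothesis q_pr : prime q.
Implicit Types (F : {set A * B}) (X : {set A}) (Y : {set B}).
Local Open Scope ring_scope.

Variable t : nat.
Hypothesis tE : t = (16 * q ^ 2)%N.
Let lam : K := t%:R - 2 * q%:R.

(* This inequality dictates the values t = 16 q^2 and c = 2 q. *)
Lemma threshold_ineq (Q T : K) : 2 <= Q -> T = 16 * Q ^+ 2 ->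
  T * (Q - 1) / (2 * Q - 1) *
    ((T - Q)^-1 + (T + 1) / ((T - Q) * (T - 2 * Q))) < 1 - (2 * (2 * Q))^-1.
Proof.
move=> Q2 TE.
have Q0 : 0 < Q by apply: lt_le_trans Q2.
have h1 : 0 < 2 * Q - 1 by lra.
have TQ : T - Q = Q * (16 * Q - 1) by rewrite TE; ring.
have TQ2 : T - 2 * Q = 2 * Q * (8 * Q - 1) by rewrite TE; ring.
have h2 : 0 < 16 * Q - 1 by lra.
have h3 : 0 < 8 * Q - 1 by lra.
rewrite -subr_gt0 TQ TQ2.
rewrite [ltRHS](_ : _ =
  (256 * Q ^+ 5 + 368 * Q ^+ 4 + 4 * Q ^+ 3 + 2 * Q ^+ 2) /
  (4 * Q * (2 * Q - 1) * (Q * (16 * Q - 1)) * (2 * Q * (8 * Q - 1)))); last first.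
  by rewrite TE; field; rewrite !gt_eqF.
by rewrite divr_gt0 ?mulr_gt0 // !addr_gt0 ?mulr_gt0 ?exprn_gt0.
Qed.

(** The hypotheses bound [p * #|X|] and the sum of [beta] by multiples of [p * #|F|];
    [threshold_ineq] then provides the slack that [sampling] needs. *)
Lemma sampled_biregular F X Y (p : K) (beta : B -> K) :
  F \subset setX X Y -> F != set0 -> (forall a, #|nbrA F a| <= t)%N ->
  ((t - q) * #|X| <= #|F|)%N ->
  0 < p -> (forall b, 0 < beta b) -> (forall b, beta b <= 1) ->
  (forall a, p <= \prod_(b in nbrA F a) beta b) ->
  (forall b, p * #|nbrB F b|%:R <= lam * beta b) ->
  \sum_(b in Y) excess F p beta b <= p * #|F|%:R ->
  (t%:R - q%:R) * lam * (\sum_(b in Y) beta b) <= p * #|F|%:R * (t%:R + 1) ->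
  exists2 F' : {set A * B}, F' \subset F & biregular q F'.
Proof.
move=> sF F0 dA hX p0 beta0 beta1 hp hload hexc hbeta.
have q2 := prime_gt1 q_pr.
have Q2 : 2 <= q%:R :> K by rewrite (ler_nat K 2).
have Q0 : 0 < q%:R :> K by apply: lt_le_trans Q2.
have cF : 0 < #|F|%:R :> K by rewrite ltr0n card_gt0.
have TE : t%:R = 16 * q%:R ^+ 2 :> K by rewrite tE natrM natrX.
have tq : (q <= t)%N by rewrite tE -mulnn mulnA leq_pmull // muln_gt0 /= ltnW.
have TQ : 0 < t%:R - q%:R :> K by rewrite TE; nra.
have L0 : 0 < lam by rewrite /lam TE; nra.
have := threshold_ineq Q2 TE; rewrite -/lam => key.
(* The sum of truncated degrees per vertex that [nearly_regular_biregular] asks for. *)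
pose mu : K := t%:R * (q%:R - 1) / (2 * q%:R - 1).
have d0 : 0 < 2 * q%:R - 1 :> K by lra.
have mu0 : 0 <= mu by rewrite /mu divr_ge0 ?mulr_ge0 ?(ltW d0) //; lra.
have c0 : 0 < 2 * q%:R :> K by rewrite mulr_gt0.
have [|X' [Y' [F1 [sF1 sF1' h1]]]] :=
    sampling (t := t) sF p0 c0 beta0 beta1 hp hload hexc (mu := mu).
  apply: (@le_lt_trans _ _ (mu * (p * #|F|%:R *
     ((t%:R - q%:R)^-1 + (t%:R + 1) / ((t%:R - q%:R) * lam))))).
    rewrite ler_wpM2l // mulrDr lerD //.
      rewrite -mulrA ler_pM2l // ler_pdivlMr // mulrC -natrB // -natrM ler_nat //.
    by rewrite mulrA ler_pdivlMr ?mulr_gt0 // mulrC.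
  rewrite mulrCA ltr_pM2l ?mulr_gt0 //.
have {}h1 : (t * (q.-1 * (#|X'| + #|Y'|)) <
    q.*2.-1 * \sum_(b in Y') minn #|nbrB F1 b| t)%N.
  have q1E : q.-1%:R = q%:R - 1 :> K by rewrite -subn1 natrB // ltnW.
  have q21E : q.*2.-1%:R = 2 * q%:R - 1 :> K.
    have h2 : (1 <= 2 * q)%N by rewrite muln_gt0 /= ltnW.
    by rewrite -mul2n -subn1 (natrB K h2) (natrM K 2 q).
  have mm : (2 * q%:R - 1) * mu = t%:R * (q%:R - 1) by rewrite /mu mulrC divfK // gt_eqF.
  move: h1; rewrite -(ltr_pM2l d0) mulrA mm => h1.
  rewrite -(ltr_nat K) (natrM K t) (natrM K q.-1) (natrM K q.*2.-1) q1E q21E.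
  by rewrite mulrA.
have dA1 a : (#|nbrA F1 a| <= t)%N.
  by apply: leq_trans (dA a); apply/subset_leq_card/nbrA_sub.
have [|F2 s2 r2] := nearly_regular_biregular q_pr sF1' _ dA1 h1.
  by rewrite -mul2n (leq_trans (leq_pred _)) // ltnW // double_lt_threshold.
by exists F2 => //; apply: subset_trans s2 sF1.
Qed.

(** All of [Y] is kept and [X] is sampled at rate [lam / M]; as [beta] is constantly 1, the excess
    vanishes. *)
Lemma balanced_biregular F X Y M :
  (t <= M)%N -> (#|Y| * M <= #|X| * t.+1)%N -> (0 < #|X|)%N ->
  F \subset setX X Y -> (forall a, #|nbrA F a| <= t)%N ->
  (forall b, #|nbrB F b| <= M)%N ->
  ((t - q) * #|X| <= #|F|)%N ->
  exists2 F' : {set A * B}, F' \subset F & biregular q F'.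
Proof.
move=> tM hXY X0 sF dA dB hF.
have tq := double_lt_threshold q_pr tE.
have qt : (q < t)%N by apply: leq_ltn_trans tq; rewrite leq_pmull.
have lamE : lam = (t - 2 * q)%N%:R by rewrite /lam (natrB K (ltnW tq)) (natrM K 2).
have M0 : 0 < M%:R :> K by rewrite ltr0n (leq_trans _ tM) // (leq_ltn_trans _ tq).
have lam0 : 0 < lam by rewrite lamE ltr0n subn_gt0.
apply: (@sampled_biregular F X Y (lam / M%:R) (fun=> 1)) => //.
- by rewrite -card_gt0; apply: leq_trans hF; rewrite muln_gt0 X0 andbT subn_gt0.
- by rewrite divr_gt0.
- move=> a; rewrite big1 // ler_pdivrMr // mul1r lamE ler_nat.
  by rewrite (leq_trans _ tM) // leq_subr.
- by move=> b; rewrite mulr1 mulrAC -mulrA ger_pMr // ler_pdivrMr // mul1r ler_nat.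
- rewrite big1; first by rewrite mulr_ge0 // divr_ge0 // ltW.
  move=> b _; rewrite /excess big1 // => a _; rewrite big1 // => a' _.
  by rewrite /pair_prob big1 // subrr.
rewrite sumr_const.
have h : (#|Y| * M * (t - q) <= #|F| * t.+1)%N.
  apply: (@leq_trans (#|X| * t.+1 * (t - q))); first by rewrite leq_mul2r hXY orbT.
  by rewrite mulnAC leq_mul2r mulnC hF orbT.
have -> : lam / M%:R * #|F|%:R * (t%:R + 1) = lam * ((#|F| * t.+1)%N%:R / M%:R).
  by rewrite (natrM K #|F|) -(natr1 t); ring.
rewrite mulrAC mulrC ler_pM2l // ler_pdivlMr // -(natrB K (ltnW qt)).
by rewrite -natrM -natrM ler_nat -mulnA mulnC.
Qed.

(** On [Y], [beta] is proportional to the degree, which makes the load bound an equality. Products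
    of at most [t] values of [beta] are at least [z ^ -(2 t)], and the codegree bound absorbs this
    loss in the excess. *)
Lemma spread_biregular F X Y z n :
  F \subset setX X Y -> F != set0 -> (forall a, #|nbrA F a| <= t)%N ->
  ((t - q) * #|X| <= #|F|)%N ->
  (forall b, b \in Y -> z ^ n <= #|nbrB F b| <= z ^ n.+2)%N ->
  (forall a b b', (a, b) \in F -> (a, b') \in F -> b' != b ->
     #|nbrB F b :&: nbrB F b'| <= z ^ (n.+1 - 2 * t))%N ->
  (2 * t <= n)%N -> (t * t <= z)%N ->
  exists2 F' : {set A * B}, F' \subset F & biregular q F'.
Proof.
move=> sF F0 dA hX dB hcod tn tz.
have tq := double_lt_threshold q_pr tE.
have t0 : (0 < t)%N by apply: leq_ltn_trans tq.
have qt : (q < t)%N by apply: leq_ltn_trans tq; rewrite leq_pmull.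
have z0 : (0 < z)%N by apply: leq_trans tz; rewrite muln_gt0 t0.
have tz' : (t <= z)%N by apply: leq_trans tz; rewrite leq_pmull.
pose Z : K := z%:R.
have Z0 : 0 < Z by rewrite ltr0n.
have lamE : lam = (t - 2 * q)%N%:R by rewrite /lam (natrB K (ltnW tq)) (natrM K 2).
have lam0 : 0 < lam by rewrite lamE ltr0n subn_gt0.
have lamt : lam <= t%:R by rewrite lamE ler_nat leq_subr.
have T0 : 0 < t%:R :> K by rewrite ltr0n.
pose M : K := Z ^+ n.+2.
have M0 : 0 < M by rewrite exprn_gt0.
pose beta b : K := if b \in Y then #|nbrB F b|%:R / M else 1.
have betaY b : b \in Y -> Z ^- 2 <= beta b.
  have ZM : Z ^- 2 * M = Z ^+ n.
    by rewrite /M -(addn2 n) exprD mulrA mulrAC mulVf ?mul1r ?expf_neq0 ?gt_eqF.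
  move=> bY; rewrite /beta bY ler_pdivlMr // ZM.
  by rewrite -natrX ler_nat; case/andP: (dB b bY).
have beta0 b : 0 < beta b.
  case: (boolP (b \in Y)) => bY; last by rewrite /beta (negPf bY).
  by apply: lt_le_trans (betaY b bY); rewrite invr_gt0 exprn_gt0.
have beta1 b : beta b <= 1.
  rewrite /beta; case: ifP => // bY; rewrite ler_pdivrMr // mul1r /M -natrX ler_nat.
  by case/andP: (dB b bY).
have Z1 : 1 <= Z by rewrite (ler_nat K 1).
have prod_lb a (W : {set B}) : W \subset nbrA F a ->
    (Z ^+ (2 * t))^-1 <= \prod_(b in W) beta b.
  move=> sW; have cW : (#|W| <= t)%N by apply: leq_trans (subset_leq_card sW) (dA a).
  apply: (@le_trans _ _ (\prod_(b in W) Z ^- 2)).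
    rewrite prodr_const exprVn -exprM lef_pV2 ?posrE ?exprn_gt0 //.
    by rewrite ler_weXn2l // leq_mul2l cW.
  apply: ler_prod => b bW; rewrite invr_ge0 exprn_ge0 ?(ltW Z0) //=; apply: betaY.
  by have := subsetP sW _ bW; rewrite inE => /(subsetP sF); rewrite inE => /andP[].
pose p : K := lam / M.
have p0 : 0 < p by rewrite divr_gt0.
apply: (@sampled_biregular F X Y p beta) => //.
- move=> a; apply: le_trans (prod_lb a _ (subxx _)).
  rewrite /p ler_pdivrMr // ler_pdivlMl ?exprn_gt0 //.
  apply: (@le_trans _ _ (Z ^+ n * Z)).
    rewrite ler_pM ?exprn_ge0 ?(ltW Z0) ?(ltW lam0) //; first exact: ler_weXn2l.
    by apply: le_trans lamt _; rewrite ler_nat.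
  by rewrite -exprSr /M ler_weXn2l.
- move=> b; rewrite /beta; case: ifPn => bY.
    by rewrite /p mulrAC -mulrA.
  rewrite (_ : nbrB F b = set0) ?cards0 ?mulr0 ?mulr1 ?(ltW lam0) //.
  apply/setP => a; rewrite !inE; apply: contraNF bY => /(subsetP sF).
  by rewrite inE => /andP[].
- rewrite (card_edgesB_in sF) natr_sum mulr_sumr; apply: ler_sum => b bY.
  rewrite /excess mulr_natr -sumr_const; apply: ler_sum => a ab.
  have abF : (a, b) \in F by rewrite inE in ab.
  (* The neighbours of [b] that share with [a] a neighbour besides [b]; all others contribute 0 to
     the excess. *)
  pose C := \bigcup_(b' in nbrA F a :\ b) (nbrB F b :&: nbrB F b').
  have cC : (#|C| <= t * z ^ (n.+1 - 2 * t))%N.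
    apply: (@leq_trans (\sum_(b' in nbrA F a :\ b) z ^ (n.+1 - 2 * t))); last first.
      rewrite sum_nat_const leq_mul2r; apply/orP; right.
      by apply: leq_trans (dA a); rewrite subset_leq_card // subD1set.
    rewrite /C; elim/big_ind2: _ => [|W1 m1 W2 m2 h1 h2|b']; rewrite ?cards0 //.
      by apply: leq_trans (leq_add h1 h2); rewrite cardsU leq_subr.
    by rewrite !inE => /andP[b'b ab']; apply: hcod abF ab' b'b.
  apply: (@le_trans _ _ (\sum_(a' in C) p ^+ 2 * Z ^+ (2 * t))).
    rewrite big_mkcond [leRHS]big_mkcond /=; apply: ler_sum => a' _.
    have ge0 : 0 <= p ^+ 2 * Z ^+ (2 * t) by rewrite mulr_ge0 // exprn_ge0 // ltW.
    case: ifPn => [/andP[a'b a'a]|_]; last by case: ifP.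
    case: ifPn => a'C.
      apply: (@le_trans _ _ (pair_prob F p beta a a')).
        by rewrite lerBlDr lerDl divr_ge0 ?exprn_ge0 ?(ltW p0) // ltW.
      rewrite /pair_prob ler_pM2l ?exprn_gt0 //.
      rewrite -[leRHS]invrK lef_pV2 ?posrE ?invr_gt0 ?exprn_gt0 ?prodr_gt0 //.
      exact: prod_lb (subsetIl _ _).
    rewrite /pair_prob (_ : nbrA F a :&: nbrA F a' = [set b]).
      by rewrite big_set1 subrr.
    apply/setP => b'; rewrite in_setI in_set1; apply/andP/eqP => [[b1 b2]|->]; last first.
      by rewrite !inE abF; rewrite inE in a'b.
    apply/eqP; apply: contraNT a'C => b'b; apply/bigcupP; exists b'.
      by rewrite !inE b'b; rewrite inE in b1.
    by rewrite !inE; rewrite inE in a'b; rewrite inE in b2; rewrite a'b b2.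
  rewrite sumr_const.
  have -> : p ^+ 2 * Z ^+ (2 * t) *+ #|C| = p * (lam * (Z ^+ (2 * t) * #|C|%:R) / M).
    by rewrite -[LHS]mulr_natr /p; field; rewrite gt_eqF.
  rewrite ger_pMr // ler_pdivrMr // mul1r.
  apply: (@le_trans _ _ (lam * (Z ^+ (2 * t) * (t * z ^ (n.+1 - 2 * t))%N%:R))).
    by rewrite ler_pM2l // ler_pM2l ?exprn_gt0 // ler_nat.
  have -> : Z ^+ (2 * t) * (t * z ^ (n.+1 - 2 * t))%N%:R = t%:R * Z ^+ n.+1.
    by rewrite (natrM K t) natrX -/Z mulrCA -exprD subnKC // ltnW // ltnS.
  rewrite mulrA /M (exprS Z n.+1) ler_pM2r ?exprn_gt0 //.
  (* [t * t <= z] pays for the one missing power of [z]. *)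
  apply: (@le_trans _ _ (t * t)%N%:R); last by rewrite ler_nat.
  by rewrite (natrM K t) ler_pM2r.
rewrite (eq_bigr (fun b => #|nbrB F b|%:R / M)); last by move=> b bY; rewrite /beta bY.
rewrite -mulr_suml -natr_sum -(card_edgesB_in sF).
have -> : p * #|F|%:R * (t%:R + 1) = (t%:R + 1) * lam * (#|F|%:R / M).
  by rewrite /p; ring.
rewrite ler_wpM2r ?divr_ge0 ?(ltW M0) // ler_pM2r // lerD2l.
by apply: le_trans ler01; rewrite oppr_le0.
Qed.

End SampledBiregular.

(** * Pairs of large codegree *)

(** Greedy choice: each chosen element discards itself and fewer than [m] related ones. *)
Lemma independent_subset (T : finType) (r : rel T) (m n : nat) (D : {set T}) :
  symmetric r -> (0 < m)%N -> (forall x, x \in D -> #|[set y in D | r x y]| < m)%N ->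
  (m * n <= #|D|)%N ->
  exists I : {set T}, [/\ I \subset D, #|I| = n &
    {in I &, forall x y, y != x -> ~~ r x y}].
Proof.
move=> r_sym m0; elim: n D => [|n IH] D hD hm.
  by exists set0; split; rewrite ?sub0set ?cards0 // => x; rewrite inE.
have [D0|[x xD]] := set_0Vmem D.
  by move: hm; rewrite D0 cards0 leqn0 muln_eq0 -leqn0 leqNgt m0.
pose W := x |: [set y in D | r x y].
have sub : D :\: W \subset D by apply: subsetDl.
have cW : (#|W| <= m)%N.
  by rewrite (leq_trans _ (hD x xD)) // cardsU1; case: (x \notin _).
have [y|| I [sI cI iI]] := IH (D :\: W).
- rewrite inE => /andP[_ /hD]; apply: leq_ltn_trans; apply: subset_leq_card.
  by apply/subsetP => w; rewrite !inE => /andP[/andP[_ ->] ->].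
- have := cardsID W D; have : (#|D :&: W| <= #|W|)%N.
    by apply/subset_leq_card/subsetIr.
  by rewrite mulnS in hm; lia.
have xI y : y \in I -> (y != x) && ~~ r x y.
  by move=> /(subsetP sI); rewrite !inE => /andP[+ yD]; rewrite yD negb_or.
exists (x |: I); split.
- by rewrite subUset sub1set xD (subset_trans sI sub).
- rewrite cardsU1 cI; suff -> : x \notin I by [].
  by apply/negP => /xI; rewrite eqxx.
- move=> y w; rewrite !inE => /orP[/eqP->|yI] /orP[/eqP->|wI]; rewrite ?eqxx //.
  + by case/andP: (xI _ wI).
  + by rewrite r_sym; case/andP: (xI _ yI).
  + exact: iI.
Qed.

Lemma bin_le_expn n k : ('C(n, k) <= n ^ k)%N.
Proof.
apply: (@leq_trans (n ^_ k)); first by rewrite -bin_ffact leq_pmulr ?fact_gt0.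
rewrite ffact_prod -[in leqRHS](card_ord k) -prod_nat_const.
by apply: leq_prod => i _; apply: leq_subr.
Qed.

Lemma exists_subset_card (T : finType) (D : {set T}) m : (m <= #|D|)%N ->
  exists2 W : {set T}, W \subset D & #|W| = m.
Proof.
move=> mD; have : (0 < #|[set W : {set T} | W \subset D & #|W| == m]|)%N.
  by rewrite cards_draws bin_gt0.
by case/card_gt0P => W; rewrite inE => /andP[? /eqP ?]; exists W.
Qed.

Section Codegrees.
Variables A B : finType.
Implicit Types (F : {set A * B}) (X : {set A}) (Y : {set B}).

Lemma complete_biregular q (W : {set A}) (Z : {set B}) :
  (0 < q)%N -> #|W| = q -> #|Z| = q -> biregular q (setX W Z).
Proof.
move=> q0 cW cZ; split; first by rewrite -card_gt0 cardsX cW cZ muln_gt0 q0.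
move=> a b; rewrite inE => /andP[/= aW bZ]; split; [rewrite -cZ|rewrite -cW];
  by apply: eq_card => x; rewrite !inE /= ?aW ?bZ ?andbT.
Qed.

Definition rich F R b b' := (b' != b) && (R < #|nbrB F b :&: nbrB F b'|)%N.

Lemma rich_sym F R : symmetric (rich F R).
Proof. by move=> b b'; rewrite /rich eq_sym setIC. Qed.

(** Counts the paths from [b] through some [a] to [b']: at most [M * s] in total, more than [R] to
    each rich partner. *)
Lemma card_rich F R s M b : (forall a, #|nbrA F a| <= s)%N -> (#|nbrB F b| <= M)%N ->
  (#|[set b' | rich F R b b']| * R <= M * s)%N.
Proof.
move=> dA dB; rewrite -sum_nat_const.
apply: (@leq_trans (\sum_(b' : B) #|nbrB F b :&: nbrB F b'|)).
  rewrite big_mkcond; apply: leq_sum => b' _; rewrite inE.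
  by case: ifP => // /andP[_ /ltnW].
apply: (@leq_trans (\sum_(a in nbrB F b) #|nbrA F a|)); last first.
  apply: (@leq_trans (\sum_(a in nbrB F b) s)); first exact: leq_sum.
  by rewrite sum_nat_const leq_mul2r dB orbT.
under eq_bigr => b' _ do rewrite -sum1_card.
under [leqRHS]eq_bigr => a _ do rewrite -sum1_card.
rewrite (exchange_big_dep (mem (nbrB F b))) /=; last by move=> b' a _; rewrite !inE => /andP[].
apply: leq_sum => a ab; rewrite !sum1_card subset_leq_card //.
apply/subsetP => b1 h; have {h} : a \in nbrB F b :&: nbrB F b1 by exact: h.
by rewrite !inE => /andP[].
Qed.

(** The obstruction to applying [independent_subset] to [nbrA F a]. *)
Definition star_heavy F R m a :=
  [exists b in nbrA F a, m <= #|[set b' in nbrA F a | rich F R b b']|]%N.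

(** Union bound over stars: a centre [b], at most [n ^ m] sets of [m] rich partners of it, and at
    most [l] vertices adjacent to the whole star. *)
Lemma card_star_heavy F X Y R m n l :
  F \subset setX X Y ->
  (forall b, b \in Y -> #|[set b' | rich F R b b']| <= n)%N ->
  (forall Z : {set B}, #|Z| = m.+1 -> #|[set a | Z \subset nbrA F a]| <= l)%N ->
  (#|[set a | star_heavy F R m a]| <= #|Y| * (n ^ m * l))%N.
Proof.
move=> sF hn hl.
pose dr b := [set Z : {set B} | (Z \subset [set b' | rich F R b b']) && (#|Z| == m)].
apply: (@leq_trans (\sum_(b in Y) \sum_(Z in dr b) #|[set a | b |: Z \subset nbrA F a]|)).
  rewrite -sum1_card.
  under [leqRHS]eq_bigr => b _ do under eq_bigr => Z _ do rewrite -sum1_card.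
  under [leqRHS]eq_bigr => b _ do rewrite (exchange_big_dep predT) //=.
  rewrite (exchange_big_dep predT) //= big_mkcond /=; apply: leq_sum => a _.
  rewrite inE; case: ifP => // /existsP[b /andP[ab hb]].
  have bY : b \in Y.
    by move: ab; rewrite inE => /(subsetP sF); rewrite inE => /andP[].
  have [Z sZ cZ] := exists_subset_card hb.
  rewrite (bigD1 b) /= ?bY // addn_gt0; apply/orP; left.
  rewrite sum1_card; apply/card_gt0P; exists Z; rewrite unfold_in /=.
  rewrite !inE cZ eqxx andbT subUset sub1set ab /=; apply/andP; split.
    by apply: subset_trans sZ _; apply/subsetP => b'; rewrite !inE => /andP[].
  by apply: subset_trans sZ _; apply/subsetP => b'; rewrite !inE => /andP[].
rewrite -sum_nat_const; apply: leq_sum => b bY.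
apply: (@leq_trans (\sum_(Z in dr b) l)).
  apply: leq_sum => Z; rewrite inE => /andP[sZ /eqP cZ]; apply: hl.
  rewrite cardsU1 cZ; suff -> : b \notin Z by [].
  by apply/negP => /(subsetP sZ); rewrite inE /rich eqxx.
rewrite sum_nat_const leq_mul2r; apply/orP; right.
rewrite cards_draws; apply: leq_trans (bin_le_expn _ _) _.
by case: m {hl dr} => // m; rewrite leq_exp2r // hn.
Qed.

End Codegrees.

(** Passing from the exponent [w * (q - 1)] to [w * q] frees a factor [z ^ w], which beats the
    constants. *)
Lemma few_star_heavy_bound q s z w : (1 < q)%N -> (0 < s)%N -> (0 < w)%N ->
  (8 * q * s ^ q <= z)%N ->
  (8 * ((s * z ^ w) ^ q.-1 * q) <= z ^ (w * q))%N.
Proof.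
case: q => [|[|q]] // _ s0 w0 /=; set Q := q.+2 => hz.
have z0 : (0 < z)%N by apply: leq_trans hz; rewrite muln_gt0 expn_gt0 s0.
rewrite expnMn -expnM.
have -> : (w * Q = w * q.+1 + w)%N by rewrite /Q (mulnS w q.+1) addnC.
rewrite expnD.
have h1 : (8 * Q * s ^ q.+1 <= z ^ w)%N.
  apply: (@leq_trans z); last by rewrite -[leqLHS]expn1 leq_pexp2l.
  by apply: leq_trans hz; rewrite leq_mul2l leq_pexp2l ?orbT.
rewrite [leqRHS]mulnC; apply: leq_trans (leq_mul h1 (leqnn _)).
by rewrite -!mulnA leq_mul2l /= mulnA mulnC.
Qed.

(** * Regular subgraphs of very unbalanced pairs *)

Section Polynomial.
Variables A B : finType.
Implicit Types (F : {set A * B}) (X : {set A}) (Y : {set B}).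

Lemma common_nbrs_biregular F q (Z : {set B}) : (0 < q)%N -> #|Z| = q ->
  (q <= #|[set a | Z \subset nbrA F a]|)%N ->
  exists2 F' : {set A * B}, F' \subset F & biregular q F'.
Proof.
move=> q0 cZ /exists_subset_card[W sW cW].
exists (setX W Z); last exact: complete_biregular.
apply/subsetP => -[a b]; rewrite inE => /andP[/= aW bZ].
have := subsetP sW _ aW; rewrite inE => /subsetP/(_ _ bZ).
by rewrite inE.
Qed.

Lemma card_rich_le F s z n w b : (0 < z)%N -> (w <= n.+1)%N ->
  (forall a, #|nbrA F a| <= s)%N -> (#|nbrB F b| <= z ^ n.+2)%N ->
  (#|[set b' | rich F (z ^ (n.+1 - w)) b b']| <= s * z ^ w.+1)%N.
Proof.
move=> z0 wn dA dB.
rewrite -(@leq_pmul2r (z ^ (n.+1 - w))) ?expn_gt0 ?z0 //.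
apply: leq_trans (card_rich _ dA dB) _.
rewrite -mulnA -expnD mulnC leq_mul2l leq_pexp2l ?orbT //; lia.
Qed.

(** Vertices of low degree carry at most half of the edges, and the others at most [4 * d] each. *)
Lemma many_large_degree F X Y d : (0 < d)%N -> F \subset setX X Y ->
  (forall a, #|nbrA F a| <= 4 * d)%N -> (2 * d * #|X| <= #|F|)%N ->
  (#|X| <= 4 * #|[set a in X | d <= #|nbrA F a|]|)%N.
Proof.
move=> d0 sF dA hF.
set G := [set a in X | _].
have : (#|F| <= \sum_(a in X) (d + 4 * d * (a \in G)))%N.
  rewrite (card_edgesA_in sF); apply: leq_sum => a aX.
  rewrite /G inE aX /=; case: (leqP d #|nbrA F a|) => h; last exact: leq_trans (ltnW h) (leq_addr _ _).
  by rewrite muln1; apply: leq_trans (dA a) (leq_addl _ _).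
rewrite big_split /= sum_nat_const -big_distrr /= -big_mkcondr /=.
rewrite (eq_bigl (mem G)); last by move=> a; rewrite /G !inE; case: (a \in X).
rewrite sum1_card => h.
have h2 : (d * #|X| <= d * (4 * #|G|))%N.
  by move: hF h; move: #|X| #|F| #|G| => x f g; nia.
by rewrite leq_pmul2l in h2.
Qed.

Lemma prune_low_degree F X Y m (Y' := [set b in Y | m <= #|nbrB F b|]%N)
    (F' := [set e in F | e.2 \in Y']) : F \subset setX X Y ->
  (#|F| <= #|F'| + #|Y| * m)%N.
Proof.
move=> sF.
have sF' : F :\: F' \subset setX X Y by apply: subset_trans (subsetDl _ _) sF.
rewrite -(cardsID F' F) leq_add //; first by rewrite subset_leq_card // subsetIr.
rewrite (card_edgesB_in sF') -sum_nat_const; apply: leq_sum => b bY.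
have [h|/ltnW h] := leqP m #|nbrB F b|.
  rewrite (_ : nbrB _ b = set0) ?cards0 //; apply/setP => a.
  by rewrite !inE /= bY h andbT; case: (_ \in F).
by apply: leq_trans h; apply/subset_leq_card/nbrB_sub/subsetDl.
Qed.

(* Either F contains K_{q,q}, or pairs with large codegree are so rare that
   almost every a has t neighbours no two of which form such a pair; the
   subgraph formed by these neighbours satisfies spread_biregular. *)
Lemma polynomial_biregular q t n z F X Y :
  prime q -> t = (16 * q ^ 2)%N -> n.+1 = ((2 * t).+1 * q)%N ->
  (8 * q * (4 * (q * t)) ^ q <= z)%N ->
  F \subset setX X Y -> (0 < #|X|)%N ->
  (forall a, #|nbrA F a| <= 4 * (q * t))%N -> (forall b, #|nbrB F b| <= z ^ n.+2)%N ->
  (2 * (q * t) * #|X| <= #|F|)%N -> (#|Y| * z ^ n.+1 <= #|X|)%N ->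
  exists2 F' : {set A * B}, F' \subset F & biregular q F'.
Proof.
move=> q_pr tE nE hz sF X0 dA dB hF hY.
have q1 := prime_gt1 q_pr; have q0 := prime_gt0 q_pr.
have t0 : (0 < t)%N by rewrite tE muln_gt0 expn_gt0 q0.
have qt0 : (0 < q * t)%N by rewrite muln_gt0 q0.
have z8 : (8 <= z)%N.
  by apply: leq_trans hz; rewrite -mulnA leq_pmulr // muln_gt0 q0 expn_gt0 muln_gt0 qt0.
have z0 : (0 < z)%N by apply: leq_trans z8.
have ttz : (t * t <= z)%N.
  apply: leq_trans hz; rewrite -[leqLHS]mul1n leq_mul ?muln_gt0 ?q0 //.
  apply: (@leq_trans ((4 * (q * t)) ^ 2)).
    by rewrite -mulnn leq_mul // mulnA leq_pmull // muln_gt0 q0.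
  by rewrite leq_pexp2l // muln_gt0 qt0.
have tn : (2 * t <= n)%N by rewrite -ltnS nE leq_pmulr.
set R := (z ^ (n.+1 - 2 * t))%N.
case: (boolP [exists Z : {set B}, (#|Z| == q) && (q <= #|[set a | Z \subset nbrA F a]|)]%N).
  by move=> /existsP[Z /andP[/eqP cZ hZ]]; apply: common_nbrs_biregular hZ.
move=> /existsPn noK.
pose bad := [set a | star_heavy F R q.-1 a].
(* Without a K_{q,q}, any [q] vertices of [B] have fewer than [q] common neighbours, so stars with
   [q - 1] leaves are rare; [n] is chosen so that [z ^ n.+1] dominates their number. *)
have few_bad : (8 * #|bad| <= #|X|)%N.
  have h : (#|bad| <= #|Y| * ((4 * (q * t) * z ^ (2 * t).+1) ^ q.-1 * q))%N.
    apply: (card_star_heavy sF) => [b _|Z cZ].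
      by apply: card_rich_le; rewrite // ltnW // ltnS.
    have := noK Z; rewrite cZ prednK // eqxx /= -ltnNge; exact: ltnW.
  apply: leq_trans hY; rewrite nE.
  apply: (@leq_trans (#|Y| * (8 * ((4 * (q * t) * z ^ (2 * t).+1) ^ q.-1 * q)))).
    by rewrite mulnCA leq_mul2l h orbT.
  by rewrite leq_mul2l few_star_heavy_bound ?orbT // muln_gt0.
pose G1 := [set a in X | q * t <= #|nbrA F a|]%N.
have cG1 : (#|X| <= 4 * #|G1|)%N by apply: (many_large_degree _ sF).
pose G := G1 :\: bad.
have cG : (#|X| <= 8 * #|G|)%N.
  have := cardsID bad G1; have : (#|G1 :&: bad| <= #|bad|)%N.
    by apply/subset_leq_card/subsetIr.
  rewrite -/G; move: few_bad cG1; clear; lia.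
have G0 : (0 < #|G|)%N by move: X0 cG; clear; lia.
(* A vertex of [G] has at least [q * t] neighbours, enough to choose [t] pairwise non-rich ones
   greedily. *)
have /fin_all_exists[f hf] : forall a, exists I : {set B}, a \in G ->
    [/\ I \subset nbrA F a, #|I| = t &
       {in I &, forall b b', b' != b -> ~~ rich F R b b'}].
  move=> a.
  case: (boolP (a \in G)) => [|_]; last by exists set0.
  rewrite !inE => /andP[nbad /andP[_ da]].
  have [||b ba||I [sI cI hI]] := @independent_subset _ (rich F R) q.-1 t (nbrA F a).
  - exact: rich_sym.
  - by rewrite -subn1 subn_gt0.
  - move: nbad; rewrite /star_heavy negb_exists => /forallP/(_ b).
    by rewrite ba /= -ltnNge.
  - by apply: leq_trans da; rewrite leq_mul2r leq_pred orbT.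
  by exists I => _; split.
pose F2 := [set e | (e.1 \in G) && (e.2 \in f e.1)].
have nF2 a : a \in G -> nbrA F2 a = f a.
  by move=> aG; apply/setP => b; rewrite 2!in_set /= aG.
have sF2F : F2 \subset F.
  apply/subsetP => -[a b]; rewrite inE /= => /andP[/hf[sf _ _] /(subsetP sf)].
  by rewrite inE.
have sF2 : F2 \subset setX G Y.
  apply/subsetP => -[a b] abF2; rewrite inE /=; apply/andP; split.
    by move: abF2; rewrite inE => /andP[].
  by have := subsetP (subset_trans sF2F sF) _ abF2; rewrite inE => /andP[].
have cF2 : #|F2| = (#|G| * t)%N.
  rewrite (card_edgesA_in sF2) -sum_nat_const; apply: eq_bigr => a aG.
  by rewrite nF2 //; case: (hf a aG).
pose Y3 := [set b in Y | z ^ n <= #|nbrB F2 b|]%N.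
pose F3 := [set e in F2 | e.2 \in Y3].
have cF3 : (#|F2| <= #|F3| + #|Y| * z ^ n)%N by apply: prune_low_degree sF2.
(* Pruning low degrees costs at most one edge per vertex of [G] on average, which the density
   [t - q] allows. *)
have lost : (#|Y| * z ^ n <= #|G|)%N.
  have h : (8 * (#|Y| * z ^ n) <= 8 * #|G|)%N.
    apply: leq_trans cG; apply: leq_trans hY; rewrite expnS mulnCA leq_mul2l.
    by rewrite leq_mul2r z8 !orbT.
  by rewrite leq_pmul2l in h.
have sF32 : F3 \subset F2 by apply/subsetP => e; rewrite inE => /andP[].
have cF3' : ((t - q) * #|G| <= #|F3|)%N.
  rewrite cF2 in cF3; have : ((t - q) * #|G| <= (t - 1) * #|G|)%N.
    by rewrite leq_mul2r leq_sub2l ?orbT.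
  have : ((t - 1) * #|G| + #|G| = #|G| * t)%N.
    by rewrite -mulSnr subn1 prednK // mulnC.
  by move: lost cF3; clear; lia.
have tq := double_lt_threshold q_pr tE.
have [||||b|a b b'|||F4 s4 r4] := @spread_biregular A B rat q q_pr t tE F3 G Y3 z n.
- apply/subsetP => -[a b]; rewrite in_setX in_set => /andP[/(subsetP sF2)].
  by rewrite in_setX => /andP[-> _].
- rewrite -card_gt0; apply: leq_trans cF3'; rewrite muln_gt0 G0 andbT subn_gt0.
  by apply: leq_ltn_trans tq; rewrite leq_pmull.
- move=> a; apply: leq_trans (subset_leq_card (nbrA_sub a sF32)) _.
  case: (boolP (a \in G)) => aG; first by rewrite nF2 //; case: (hf a aG) => _ ->.
  rewrite (_ : nbrA F2 a = set0) ?cards0 //; apply/setP => b.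
  by rewrite 2!in_set in_set0 /= (negPf aG).
- by [].
- move=> bY3; have -> : nbrB F3 b = nbrB F2 b.
    by apply/setP => a; rewrite [LHS]in_set [LHS]in_set /= bY3 andbT [RHS]in_set.
  have := bY3; rewrite inE => /andP[_ ->] /=.
  by apply: leq_trans (dB b); apply/subset_leq_card/nbrB_sub.
- move=> abF ab'F b'b.
  have := subsetP sF32 _ abF; rewrite inE /= => /andP[aG bf].
  have := subsetP sF32 _ ab'F; rewrite inE /= => /andP[_ b'f].
  have [_ _ /(_ b b' bf b'f b'b)] := hf a aG.
  rewrite /rich b'b -leqNgt; apply: leq_trans; apply: subset_leq_card.
  by apply: setISS; apply: nbrB_sub; apply: subset_trans sF32 sF2F.
- exact: tn.
- exact: ttz.
by exists F4 => //; apply: subset_trans s4 (subset_trans sF32 sF2F).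
Qed.

End Polynomial.

(** * The density increment *)

Section Increment.
Variables (A B : finType) (E : {set A * B}).
Implicit Types (F : {set A * B}) (X : {set A}) (Y : {set B}).

(** Max-flow min-cut with capacity [m] on [X0] and [M] on [Y0]; in the second case [X], [Y] is the
    source side of a small cut. *)
Lemma subgraph_or_cut X0 Y0 m M n :
  (exists F, [/\ F \subset E, F \subset setX X0 Y0, (n <= #|F|)%N,
     forall a, (#|nbrA F a| <= m)%N & forall b, (#|nbrB F b| <= M)%N]) \/
  (exists X Y, [/\ X \subset X0, Y \subset Y0 &
     m * #|X0 :\: X| + M * #|Y| + \sum_(a in X) #|nbrA E a :&: (Y0 :\: Y)| < n]%N).
Proof.
pose E1 := edges_between E X0 Y0.
pose u a := (m * (a \in X0))%N; pose v b := (M * (b \in Y0))%N.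
case: (boolP [forall X, forall Y, n <= cut u v E1 X Y]%N) => [/forallP h|].
  left; have [X Y|F [sF nF uF vF]] := @degree_constrained_subgraph _ _ E1 u v n.
    by move/forallP: (h X); apply.
  exists F; split=> //.
  - by apply: subset_trans sF (subsetIl _ _).
  - by apply: subset_trans sF (subsetIr _ _).
  - by move=> a; apply: leq_trans (uF a) _; rewrite -[leqRHS]muln1 leq_mul2l leq_b1 orbT.
  - by move=> a; apply: leq_trans (vF a) _; rewrite -[leqRHS]muln1 leq_mul2l leq_b1 orbT.
move=> /forallPn[X1 /forallPn[Y1]]; rewrite -ltnNge => hcut; right.
exists (X0 :&: X1), (Y0 :&: Y1); split; rewrite ?subsetIl //.
apply: leq_ltn_trans hcut; rewrite /cut !leq_add //.
- rewrite -sum1_card big_distrr /= big_mkcond /=; apply: leq_sum => a _.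
  by rewrite /u !inE; case: (a \in X0); case: (a \in X1) => //=; rewrite mul1n.
- rewrite -sum1_card big_distrr /= big_mkcond /=; apply: leq_sum => a _.
  by rewrite /v !inE; case: (a \in Y0); case: (a \in Y1) => //=; rewrite mul1n.
have -> : (\sum_(e in E1) (e.1 \in X1) && (e.2 \notin Y1))%N =
    #|[set e in E1 | (e.1 \in X1) && (e.2 \notin Y1)]|.
  rewrite -sum1_card big_mkcond [RHS]big_mkcond /=; apply: eq_bigr => e _.
  by rewrite [in RHS]in_set; case: (e \in E1) => //=; case: (_ && _).
rewrite card_edgesA big_mkcond /=; apply: leq_sum => a _.
case: ifP => //; rewrite inE => /andP[aX0 aX1]; apply: subset_leq_card.
apply/subsetP => b; rewrite !inE /= aX0 aX1 => /andP[-> /andP[]] /=.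
by case: (b \in Y0).
Qed.

(* The ratio #|Y| / #|X| is at most x / y. *)
Definition dense_pair d x y := exists X Y,
  [/\ (0 < #|X|)%N, (#|Y| * y <= #|X| * x)%N &
      forall a, a \in X -> (d <= #|nbrA E a :&: Y|)%N].

(** Markov's inequality: vertices sending more than [L] edges to [Y0 :\: Y] are discarded. *)
Lemma restrict_to_low_loss X0 Y0 X Y d L :
  (forall a, a \in X0 -> (d <= #|nbrA E a :&: Y0|)%N) ->
  X \subset X0 -> Y \subset Y0 ->
  exists X1, [/\ X1 \subset X,
    (L * #|X| <= L * #|X1| + \sum_(a in X) #|nbrA E a :&: (Y0 :\: Y)|)%N &
    forall a, a \in X1 -> (d - L <= #|nbrA E a :&: Y|)%N].
Proof.
move=> hd sX sY.
exists [set a in X | #|nbrA E a :&: (Y0 :\: Y)| <= L]%N; split.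
- by apply/subsetP => a; rewrite inE => /andP[].
- rewrite -!sum1_card !big_distrr /=.
  rewrite big_mkcond [X in (_ <= X + _)%N]big_mkcond [X in (_ <= _ + X)%N]big_mkcond.
  rewrite -big_split /=; apply: leq_sum => a _; rewrite inE muln1.
  case: (a \in X) => //=; case: (leqP #|nbrA E a :&: (Y0 :\: Y)| L) => h; clear -h; lia.
move=> a; rewrite inE => /andP[aX hL]; have := hd a (subsetP sX _ aX).
have : (#|nbrA E a :&: Y0| <= #|nbrA E a :&: Y| + #|nbrA E a :&: (Y0 :\: Y)|)%N.
  apply: leq_trans (leq_card_setU _ _); apply/subset_leq_card/subsetP => b.
  by rewrite !inE => /andP[-> ->]; case: (b \in Y).
by move: hL; lia.
Qed.

Variables (q t : nat).
Hypothesis q_pr : prime q.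
Hypothesis tE : t = (16 * q ^ 2)%N.

Let win := exists2 F : {set A * B}, F \subset E & biregular q F.

(** A small cut shrinks the ratio by the factor [1 - 1 / (16 q)]; discarding a fraction of at most
    [1 / (32 q)] of [X] still leaves a gain of [1 - 1 / (32 q)]. *)
Lemma balanced_step d x y : (0 < x <= y)%N -> dense_pair d x y ->
  win \/ dense_pair (d - 32 * q * t) ((32 * q - 1) * x) (32 * q * y).
Proof.
move=> /andP[x0 xy] [X0 [Y0 [X0n hXY hd]]].
have q0 := prime_gt0 q_pr.
have tq := double_lt_threshold q_pr tE.
(* The least integer above [t / rho] for [rho = x / y]; it is at least [t] because [rho <= 1]. *)
set M := (t * y %/ x).+1.
have Mx : (M * x <= t * y + x)%N by rewrite /M mulSn addnC leq_add2r leq_divM.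
have Mx' : (t * y < M * x)%N by rewrite /M ltn_ceil.
have tM : (t <= M)%N by rewrite /M leqW // leq_divRL // leq_mul2l xy orbT.
have [[F [sFE sF nF uF vF]]|[X [Y [sX sY hcut]]]] :=
    subgraph_or_cut X0 Y0 t M ((t - q) * #|X0|).
  left; have [|F' sF' rF'] := balanced_biregular rat q_pr tE tM _ X0n sF uF vF nF.
  - rewrite -(leq_pmul2r x0); apply: (@leq_trans (#|Y0| * (t.+1 * y))).
      rewrite -mulnA leq_mul2l; apply/orP; right.
      by apply: leq_trans Mx _; rewrite mulSn addnC leq_add2r.
    by rewrite mulnCA -mulnA [leqRHS]mulnCA leq_mul2l hXY orbT.
  by exists F' => //; apply: subset_trans sF' sFE.
right; have [X1 [sX1 cX1 dX1]] := restrict_to_low_loss (32 * q * t) hd sX sY.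
move: cX1 hcut; set e := (\sum_(a in X) _)%N => cX1 hcut.
have cX : (#|X0 :\: X| + #|X| = #|X0|)%N.
  by rewrite -(cardsID X X0) (setIidPr sX) addnC.
have h1 : (M * #|Y| + e + q * #|X0| < t * #|X|)%N.
  have e1 : (t * #|X0 :\: X| + t * #|X| = t * #|X0|)%N by rewrite -mulnDr cX.
  have e2 : ((t - q) * #|X0| + q * #|X0| = t * #|X0|)%N.
    by rewrite -mulnDl subnK //; move: tq; clear; lia.
  by move: e1 e2 hcut; clear; lia.
have h2 : (M * #|Y| <= (t - q) * #|X|)%N.
  have : (q * #|X| <= q * #|X0|)%N by rewrite leq_mul2l subset_leq_card ?orbT.
  have : ((t - q) * #|X| + q * #|X| = t * #|X|)%N.
    by rewrite -mulnDl subnK //; move: tq; clear; lia.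
  by move: h1; clear; lia.
have t0 : (0 < t)%N by apply: leq_ltn_trans tq.
have h3 : (32 * q * #|X| <= 32 * q * #|X1| + #|X|)%N.
  rewrite -(leq_pmul2l t0).
  by move: cX1 h1; clear; nia.
have X0' : (0 < #|X|)%N.
  by rewrite lt0n; apply/eqP => X0'; move: h1; rewrite X0' muln0.
exists X1, Y; split=> //.
  rewrite lt0n; apply/eqP => X10; move: h3; rewrite X10 muln0 add0n.
  by rewrite leqNgt ltn_Pmull //; move: q0; clear; lia.
(* The factor is [(t - q) / t], where [q / t = 1 / (16 q)]. *)
have h4 : (16 * q * (y * #|Y|) <= (16 * q - 1) * (x * #|X|))%N.
  have : (t * y * #|Y| <= (t - q) * (x * #|X|))%N.
    apply: (@leq_trans (M * x * #|Y|)); first by rewrite leq_mul2r ltnW ?orbT.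
    by rewrite mulnAC [leqRHS]mulnCA mulnC leq_mul2l h2 orbT.
  have -> : (t = q * (16 * q))%N by rewrite tE; clear; lia.
  have -> : (q * (16 * q) - q = q * (16 * q - 1))%N by rewrite mulnBr muln1.
  by rewrite -!mulnA leq_pmul2l // !mulnA.
have q32 : (0 < 32 * q)%N by rewrite muln_gt0.
rewrite -(leq_pmul2l q32).
move: h3 h4 q0; move: #|X| #|X1| #|Y| => a a1 b; clear.
case: q => // p h3 h4 _.
have h5 : ((32 * p.+1 - 1) * (x * a) <= 32 * p.+1 * (x * a1))%N by nia.
have h6 : ((32 * p.+1 - 1) * ((32 * p.+1 - 1) * (x * a)) <=
   (32 * p.+1 - 1) * (32 * p.+1 * (x * a1)))%N by rewrite leq_mul2l h5 orbT.
(* The square of [1 - 1 / (32 q)] is at least [1 - 1 / (16 q)]. *)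
have h7 : (64 * p.+1 * ((16 * p.+1 - 1) * (x * a)) <=
   (32 * p.+1 - 1) * ((32 * p.+1 - 1) * (x * a)))%N.
  by rewrite !mulnA leq_mul2r; apply/orP; right; rewrite leq_mul2r; apply/orP; right; nia.
have h8 : (64 * p.+1 * (16 * p.+1 * (y * b)) <= 64 * p.+1 * ((16 * p.+1 - 1) * (x * a)))%N.
  by rewrite leq_mul2l h4 orbT.
have e1 : (32 * p.+1 * (b * (32 * p.+1 * y)) = 64 * p.+1 * (16 * p.+1 * (y * b)))%N.
  by clear; lia.
have e2 : (32 * p.+1 * (a1 * ((32 * p.+1 - 1) * x)) =
    (32 * p.+1 - 1) * (32 * p.+1 * (x * a1)))%N.
  by move: (32 * p.+1 - 1)%N => w; clear; lia.
by rewrite e1 e2; apply: leq_trans h8 (leq_trans h7 h6).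
Qed.

Let s := (4 * (q * t))%N.

(** With [rho = 2 ^ -(h * n.+1)] and [z = 2 ^ h], the cap [z ^ n.+2] is [rho] to the power
    [-(1 + 1 / n.+1)]. A small cut improves [rho] by [2 ^ -h] up to the constant [2 * s], of which
    the factor [2 ^ -(u * n.+1)] is kept. *)
Lemma polynomial_step d n h u : n.+1 = ((2 * t).+1 * q)%N ->
  (8 * q * s ^ q <= 2 ^ h)%N -> (2 * s * 2 ^ (u * n.+1) <= 2 ^ h)%N ->
  dense_pair d 1 (2 ^ (h * n.+1)) ->
  win \/ dense_pair (d - 2 * s) 1 (2 ^ ((h + u) * n.+1)).
Proof.
move=> nE hz hu [X0 [Y0 [X0n hXY hd]]].
have q0 := prime_gt0 q_pr.
have tq := double_lt_threshold q_pr tE.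
have qt0 : (0 < q * t)%N by rewrite muln_gt0 q0 (leq_ltn_trans _ tq).
pose z := (2 ^ h)%N; rewrite muln1 in hXY.
have [[F [sFE sF nF uF vF]]|[X [Y [sX sY hcut]]]] :=
    subgraph_or_cut X0 Y0 s (z ^ n.+2) (2 * (q * t) * #|X0|).
  left; have [|F' sF' rF'] :=
    @polynomial_biregular A B q t n z F X0 Y0 q_pr tE nE hz sF X0n uF vF nF.
  - by rewrite /z -expnM.
  by exists F' => //; apply: subset_trans sF' sFE.
right; have [X1 [sX1 cX1 dX1]] := restrict_to_low_loss (2 * s) hd sX sY.
move: cX1 hcut; set e := (\sum_(a in X) _)%N => cX1 hcut.
have cX : (#|X0 :\: X| + #|X| = #|X0|)%N.
  by rewrite -(cardsID X X0) (setIidPr sX) addnC.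
have h1 : (z ^ n.+2 * #|Y| + e < s * #|X|)%N.
  have e1 : (s * #|X0 :\: X| + s * #|X| = s * #|X0|)%N by rewrite -mulnDr cX.
  have e2 : (2 * (q * t) * #|X0| <= s * #|X0|)%N
    by apply: leq_mul => //; apply: leq_mul.
  by move: e1 e2 hcut; clear; lia.
have s0 : (0 < s)%N by rewrite muln_gt0.
have h3 : (#|X| <= 2 * #|X1|)%N.
  rewrite -(leq_pmul2l s0).
  by move: cX1 h1; clear; lia.
have X0' : (0 < #|X|)%N.
  by rewrite lt0n; apply/eqP => X0'; move: h1; rewrite X0' muln0.
exists X1, Y; split=> //; first by move: X0' h3; clear; lia.
rewrite muln1 mulnDl expnD -[leqRHS]mul1n.
have s2 : (0 < 2 * s)%N by rewrite muln_gt0.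
rewrite -(leq_pmul2l s2) mul1n.
apply: (@leq_trans (z ^ n.+2 * #|Y|)).
  rewrite /z -(expnM 2 h n.+2) (mulnS h n.+1) (expnD 2 h).
  move: hu; move: (2 ^ (u * n.+1))%N (2 ^ (h * n.+1))%N (2 ^ h)%N (2 * s)%N => a b c w.
  move=> hw; have -> : (w * (#|Y| * (b * a)) = w * a * (b * #|Y|))%N by clear; lia.
  by rewrite -[leqRHS]mulnA leq_mul2r hw orbT.
rewrite -mulnA mulnCA; apply: leq_trans (_ : s * #|X| <= _)%N.
  by apply: ltnW; apply: leq_ltn_trans h1; apply: leq_addr.
by rewrite leq_mul2l h3 orbT.
Qed.

Lemma iterate_balanced_step i d : dense_pair d 1 1 ->
  win \/ dense_pair (d - i * (32 * q * t)) ((32 * q - 1) ^ i) ((32 * q) ^ i).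
Proof.
have q0 := prime_gt0 q_pr.
move=> h; elim: i => [|i [|IH]]; [|by left|].
  by right; rewrite mul0n subn0 !expn0.
have [||h'] := balanced_step _ IH; [|by left|].
  apply/andP; split; first by rewrite expn_gt0 subn_gt0; move: q0; clear; lia.
  by case: i {IH} => // i; rewrite leq_exp2r // leq_subr.
by right; rewrite mulSnr subnDA !expnS.
Qed.

(** Steps of fixed size [u = 2 ^ i] stay admissible, as [h] is at least [2 * n.+1 * 2 ^ i]
    throughout. *)
Lemma iterate_polynomial_step d n i r : n.+1 = ((2 * t).+1 * q)%N ->
  (8 * q * s ^ q <= 2 ^ (2 ^ i))%N ->
  dense_pair d 1 (2 ^ (2 * n.+1 * 2 ^ i * n.+1)) ->
  win \/ dense_pair (d - r * (2 * s)) 1 (2 ^ ((2 * n.+1 + r) * 2 ^ i * n.+1)).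
Proof.
move=> nE hi h0; elim: r => [|r [|IH]]; [|by left|].
  by right; rewrite mul0n subn0 addn0.
have q0 := prime_gt0 q_pr.
have tq := double_lt_threshold q_pr tE.
have qt0 : (0 < q * t)%N by rewrite muln_gt0 q0 (leq_ltn_trans _ tq).
have s0 : (0 < s)%N by rewrite muln_gt0.
have s2 : (2 * s <= 2 ^ (2 ^ i))%N.
  apply: leq_trans hi; apply: leq_mul; first by move: q0; clear; lia.
  by rewrite -[leqLHS]expn1 leq_pexp2l.
have [|||h'] := polynomial_step (u := 2 ^ i) nE _ _ IH; [| |by left|].
- apply: leq_trans hi _; rewrite leq_pexp2l // leq_pmull //.
- apply: leq_trans (leq_mul s2 (leqnn _)) _.
  rewrite -expnD leq_pexp2l // mulnC -mulSn leq_mul2r; apply/orP; right.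
  by clear; lia.
by right; rewrite (mulSnr r) subnDA addnS (mulSnr (2 * n.+1 + r)).
Qed.

(** [2 * n.+1] steps of size [2 ^ i] double [h]: the exponent of the ratio doubles at a constant
    cost in [d], which is the source of the double logarithm. *)
Lemma iterate_doubling d n i j : n.+1 = ((2 * t).+1 * q)%N ->
  (8 * q * s ^ q <= 2 ^ (2 ^ i))%N ->
  dense_pair d 1 (2 ^ (2 * n.+1 * 2 ^ i * n.+1)) ->
  win \/ dense_pair (d - j * (2 * n.+1 * (2 * s))) 1 (2 ^ (2 * n.+1 * 2 ^ (i + j) * n.+1)).
Proof.
move=> nE hi h0; elim: j => [|j [|IH]]; [|by left|].
  by right; rewrite mul0n subn0 addn0.
have hij : (8 * q * s ^ q <= 2 ^ (2 ^ (i + j)))%N.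
  by apply: leq_trans hi _; rewrite !leq_pexp2l // leq_addr.
have [|h'] := iterate_polynomial_step (2 * n.+1) nE hij IH; first by left.
have e : (2 * n.+1 * 2 ^ (i + j.+1) = (2 * n.+1 + 2 * n.+1) * 2 ^ (i + j))%N.
  by rewrite addnS expnS addnn -mul2n mulnCA mulnA.
by right; rewrite (mulSnr j) subnDA e.
Qed.

(** Counting edges from both sides bounds the ratio below by [1 / D], which stops the iteration. *)
Lemma dense_pair_bound d x y D : (0 < d)%N -> (forall b, #|nbrB E b| <= D)%N ->
  dense_pair d x y -> (y <= D * x)%N.
Proof.
move=> d0 dB [X [Y [X0 hXY hd]]].
have h : (#|X| <= #|Y| * D)%N.
  apply: (@leq_trans #|edges_between E X Y|).
    rewrite -sum1_card (card_edgesA_in (subsetIr _ _)); apply: leq_sum => a aX.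
    apply: leq_trans (leq_trans d0 (hd a aX)) _; apply: subset_leq_card.
    by apply/subsetP => b; rewrite !inE /= aX.
  rewrite (card_edgesB_in (subsetIr _ _)) -sum_nat_const; apply: leq_sum => b _.
  by apply: leq_trans (dB b); apply/subset_leq_card/nbrB_sub/subsetIl.
have Y0 : (0 < #|Y|)%N by case: #|Y| h => //; move: X0; clear; lia.
rewrite -(leq_pmul2l Y0); apply: leq_trans hXY _.
by rewrite mulnA leq_mul2r h orbT.
Qed.

End Increment.

(** * Running the increment to its end *)

Lemma bernoulli_nat c i : (c ^ i * (c + i) <= c * c.+1 ^ i)%N.
Proof.
elim: i => [|i IH]; first by rewrite !expn0 addn0 mul1n muln1.
rewrite !expnS; move: IH; move: (c ^ i)%N (c.+1 ^ i)%N => a b IH.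
by nia.
Qed.

Lemma expn_ratio c P : (0 < c)%N -> exists i, (c ^ i * P <= c.+1 ^ i)%N.
Proof.
move=> c0; exists (c * P)%N; rewrite -(leq_pmul2l c0).
apply: leq_trans (bernoulli_nat c (c * P)).
by rewrite mulnCA leq_mul2l leq_addl orbT.
Qed.

Lemma dense_pair_biregular q : prime q -> exists C : nat,
  forall (A B : finType) (E : {set A * B}) (D J d : nat),
  (forall b, #|nbrB E b| <= D)%N -> (D < 2 ^ (2 ^ J))%N -> (C * J.+1 <= d)%N ->
  dense_pair E d 1 1 -> exists2 F : {set A * B}, F \subset E & biregular q F.
Proof.
move=> q_pr; have q0 := prime_gt0 q_pr.
pose t := (16 * q ^ 2)%N; have tE : t = (16 * q ^ 2)%N by [].
pose s := (4 * (q * t))%N.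
pose i := (8 * q * s ^ q)%N.
have nE : ((2 * t).+1 * q).-1.+1 = ((2 * t).+1 * q)%N by rewrite prednK // muln_gt0.
move: nE; set n := (_ * q).-1 => nE.
have hi : (8 * q * s ^ q <= 2 ^ (2 ^ i))%N.
  by apply: leq_trans (ltnW (ltn_expl _ (leqnn 2))); apply: ltnW; apply: ltn_expl.
have c0 : (0 < 32 * q - 1)%N by rewrite subn_gt0; move: q0; clear; lia.
have cE : (32 * q - 1).+1 = (32 * q)%N by move: q0; clear; lia.
(* [i1] balanced steps, a number depending on [q] only, bring the ratio down to where doubling
   starts. *)
have [i1] := @expn_ratio (32 * q - 1) (2 ^ (2 * n.+1 * 2 ^ i * n.+1)) c0.
rewrite cE => hi1.
(* The degree lost in the balanced phase, the degree lost per doubling, and 1 to keep the final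
   degree positive. *)
exists (i1 * (32 * q * t) + 2 * n.+1 * (2 * s) + 1)%N.
move=> A B E D J d dB DJ hd h0.
have [//|h1] := iterate_balanced_step q_pr tE i1 h0.
have {}h1 : dense_pair E (d - i1 * (32 * q * t)) 1 (2 ^ (2 * n.+1 * 2 ^ i * n.+1)).
  case: h1 => X [Y [X0 hXY hX]]; exists X, Y; split=> //; rewrite muln1.
  have e0 : (0 < (32 * q - 1) ^ i1)%N by rewrite expn_gt0 c0.
  rewrite -(leq_pmul2r e0); apply: leq_trans hXY.
  by rewrite -mulnA leq_mul2l mulnC hi1 orbT.
have [//|h2] := iterate_doubling q_pr tE J nE hi h1.
have d0 : (0 < d - i1 * (32 * q * t) - J * (2 * n.+1 * (2 * s)))%N.
  rewrite -subnDA subn_gt0; apply: leq_trans hd.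
  move: (i1 * _)%N (2 * n.+1 * _)%N => a b; clear; nia.
have := dense_pair_bound d0 dB h2; rewrite muln1 => h3.
have : (2 ^ (2 ^ J) <= D)%N.
  apply: leq_trans h3; rewrite leq_pexp2l //.
  apply: (@leq_trans (2 ^ (i + J))); first by rewrite leq_pexp2l // leq_addl.
  by rewrite mulnAC leq_pmull.
by rewrite leqNgt DJ.
Qed.

(** * From graphs to bipartite graphs *)

(** The pair maximises the number of edges plus [d] for each deleted vertex; deleting a vertex of
    degree below [d] would increase this quantity. *)
Lemma min_degree_pair (A B : finType) (E : {set A * B}) d :
  (d * (#|A| + #|B|) < #|E|)%N ->
  exists X Y, [/\ X != set0, Y != set0,
    forall a, a \in X -> (d <= #|nbrA E a :&: Y|)%N &
    forall b, b \in Y -> (d <= #|nbrB E b :&: X|)%N].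
Proof.
move=> hE.
pose phi (P : {set A} * {set B}) :=
  (#|edges_between E P.1 P.2| + d * (#|~: P.1| + #|~: P.2|))%N.
pose P0 : {set A} * {set B} := (setT, setT).
case: (@arg_maxnP _ P0 predT phi isT) => -[X Y] _ hmax.
(* Otherwise the maximum is at most [d * (#|A| + #|B|)], less than the value [#|E|] at the full
   pair. *)
have e0 : (0 < #|edges_between E X Y|)%N.
  have := hmax P0 isT; rewrite /phi /= !setCT !cards0 addn0 muln0 addn0.
  have -> : edges_between E [set: A] [set: B] = E.
    by apply/setP => -[a b]; rewrite !inE; case: (_ \in E).
  have : (d * (#|~: X| + #|~: Y|) <= d * (#|A| + #|B|))%N.
    by rewrite leq_mul2l leq_add ?max_card ?orbT.
  move=> h1 h2; rewrite lt0n; apply/eqP => h0; move: h2; rewrite h0 add0n => h2.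
  by have := leq_ltn_trans (leq_trans h2 h1) hE; rewrite ltnn.
have [[a0 b0]] := card_gt0P e0; rewrite !inE /= => /andP[_ /andP[a0X b0Y]].
exists X, Y; split.
- by apply/set0Pn; exists a0.
- by apply/set0Pn; exists b0.
- move=> a aX; have := hmax (X :\ a, Y) isT; rewrite /phi /=.
  have -> : #|edges_between E X Y| =
      (#|nbrA E a :&: Y| + #|edges_between E (X :\ a) Y|)%N.
    rewrite (card_edgesA_in (subsetIr E (setX X Y))) (bigD1 a aX) /=.
    rewrite (card_edgesA_in (subsetIr E (setX (X :\ a) Y))); congr (_ + _)%N.
      by apply: eq_card => b; rewrite !inE /= aX.
    apply: eq_big => x; first by rewrite !inE andbC.
    move=> /andP[xX xa]; apply: eq_card => b; rewrite !inE /=.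
    by rewrite xa.
  have -> : #|~: (X :\ a)| = #|~: X|.+1.
    by rewrite setCD setUC cardsU1 inE aX.
  by rewrite addSn mulnS addnCA -addnA leq_add2r.
- move=> b bY; have := hmax (X, Y :\ b) isT; rewrite /phi /=.
  have -> : #|edges_between E X Y| =
      (#|nbrB E b :&: X| + #|edges_between E X (Y :\ b)|)%N.
    rewrite (card_edgesB_in (subsetIr E (setX X Y))) (bigD1 b bY) /=.
    rewrite (card_edgesB_in (subsetIr E (setX X (Y :\ b)))); congr (_ + _)%N.
      by apply: eq_card => a; rewrite !inE /= bY andbT.
    apply: eq_big => x; first by rewrite !inE andbC.
    move=> /andP[xY xb]; apply: eq_card => a; rewrite !inE /=.
    by rewrite xb.
  have -> : #|~: (Y :\ b)| = #|~: Y|.+1.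
    by rewrite setCD setUC cardsU1 inE bY.
  by rewrite addnS mulnS addnCA -addnA leq_add2r.
Qed.

Section Graph.
Variables (T : finType) (e : rel T).
Hypothesis e_simple : simple_graph e.

Definition crossing (S : {set T}) : {set T * T} :=
  [set p | [&& e p.1 p.2, p.1 \in S & p.2 \notin S]].

Definition arcs : {set T * T} := [set p | e p.1 p.2].

Lemma num_edges_le_arcs : (num_edges e <= #|arcs|)%N.
Proof.
apply: leq_trans (leq_imset_card (fun p : T * T => [set p.1; p.2]) arcs).
apply/subset_leq_card/subsetP => Z; rewrite inE.
move=> /andP[/cards2P[x [y [xy ZE]]] /forallP h]; rewrite ZE.
apply/imsetP; exists (x, y) => //; rewrite inE /=.
have := h x; rewrite ZE !inE eqxx /= => /forallP/(_ y).
by rewrite !inE eqxx orbT /= xy.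
Qed.

Local Open Scope ring_scope.

(** For uniformly random [S], an arc leaves [S] with probability [1/2 - 1/4]. *)
Lemma large_cut m : (4 * m < #|arcs|)%N -> exists S, (m < #|crossing S|)%N.
Proof.
move=> hm; have [_ e_irr] := e_simple.
pose pr (_ : T) : rat := 2%:R^-1.
pose f (S : {set T}) : rat := \sum_(p in arcs)
  (([set p.1] \subset S)%:R - ([set p.1; p.2] \subset S)%:R) -
  m%:R * (set0 \subset S)%:R.
have [||S] := @expect_gt0 _ _ pr f.
- by move=> v; rewrite /pr; lra.
- rewrite /f expectB expectZ expect_sum expect_subset big_set0.
  rewrite (eq_bigr (fun=> 4%:R^-1)) => [|[x y]]; last first.
    rewrite inE /= => exy; have xy : x != y by apply: contraTneq exy => ->; rewrite e_irr.
    rewrite expectB !expect_subset big_set1 big_setU1 ?inE //= big_set1.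
    by rewrite /pr; lra.
  rewrite sumr_const -[_ *+ #|_|]mulr_natr.
  have : (4 * m)%N%:R < #|arcs|%:R :> rat by rewrite ltr_nat.
  rewrite natrM; lra.
rewrite /f sub0set mulr1 subr_gt0 => h; exists S.
rewrite -(ltr_nat rat); apply: lt_le_trans h _.
rewrite -sum1_card natr_sum [leRHS]big_mkcond /= big_mkcond /=.
apply: ler_sum => -[x y] _; rewrite !inE /= subUset !sub1set.
by case: (e x y) => //=; case: (x \in S); case: (y \in S).
Qed.

(** No vertex is both a first and a second coordinate of [F], so symmetrising [F] keeps all
    degrees. *)
Lemma biregular_crossing k S (F : {set T * T}) : F \subset crossing S ->
  biregular k F -> has_k_regular_subgraph e k.
Proof.
move=> sF [F0 rF]; have [e_sym _] := e_simple.
have hF x y : (x, y) \in F -> [/\ e x y, x \in S & y \notin S].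
  by move=> /(subsetP sF); rewrite inE => /and3P[].
pose f x y := ((x, y) \in F) || ((y, x) \in F).
exists ([set p.1 | p in F] :|: [set p.2 | p in F]), f; split.
  have [[x y] xyF] := set0Pn _ F0; apply/set0Pn; exists x.
  by rewrite inE; apply/orP; left; apply/imsetP; exists (x, y).
split; first by move=> x y; rewrite /f orbC.
split; first by move=> x y /orP[/hF[]|/hF[]] // h _ _; rewrite e_sym.
split.
  move=> x y /orP[] h; rewrite !inE; apply/andP; split; apply/orP.
  - by left; apply/imsetP; exists (x, y).
  - by right; apply/imsetP; exists (x, y).
  - by right; apply/imsetP; exists (y, x).
  - by left; apply/imsetP; exists (y, x).
move=> v; rewrite inE => /orP[]/imsetP[[x y] xyF /= ->].
  have [_ xS _] := hF _ _ xyF; have [<- _] := rF _ _ xyF.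
  apply: eq_card => u; rewrite !inE /f; case: ((x, u) \in F) => //=.
  by apply/negP => /hF[_ _]; rewrite xS.
have [_ _ yS] := hF _ _ xyF; have [_ <-] := rF _ _ xyF.
apply: eq_card => u; rewrite !inE /f orbC; case: ((u, y) \in F) => //=.
by apply/negP => /hF[_]; rewrite (negPf yS).
Qed.

Lemma card_nbrB_crossing S y : (#|nbrB (crossing S) y| <= max_degree e)%N.
Proof.
have [e_sym _] := e_simple.
apply: leq_trans (leq_bigmax (F := fun v => degree e v) y).
by apply/subset_leq_card/subsetP => x; rewrite !inE /= e_sym => /and3P[].
Qed.

Lemma nbrB_crossing S y : nbrB (crossing S) y = nbrA (crossing (~: S)) y.
Proof.
have [e_sym _] := e_simple.
apply/setP => x; rewrite !inE /= negbK e_sym.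
by case: (e y x); case: (x \in S); case: (y \in S).
Qed.

(** A factor 4 comes from the random cut and a factor 2 from [T] serving as both sides. The larger
    side becomes [X]; complementing [S] exchanges the sides. *)
Lemma dense_pair_crossing d : (8 * (d * #|T|) < num_edges e)%N ->
  exists S, dense_pair (crossing S) d 1 1.
Proof.
move=> hd.
have [|S hS] := @large_cut (2 * (d * #|T|)).
  by apply: leq_trans num_edges_le_arcs; rewrite mulnA.
have [|X [Y [X0 Y0 hX hY]]] := @min_degree_pair _ _ (crossing S) d.
  by apply: leq_trans hS; rewrite addnn -mul2n mulnCA.
have [XY|/ltnW XY] := leqP #|Y| #|X|.
  by exists S, X, Y; split; rewrite ?card_gt0 ?muln1.
exists (~: S), Y, X; split; rewrite ?card_gt0 ?muln1 // => y yY.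
by rewrite -nbrB_crossing; apply: hY.
Qed.

End Graph.

Lemma regular_subgraph_nat k : (0 < k)%N -> exists C : nat,
  forall (T : finType) (e : rel T) (J : nat), simple_graph e ->
  (max_degree e < 2 ^ (2 ^ J))%N -> (C * (J.+1 * #|T|) < num_edges e)%N ->
  has_k_regular_subgraph e k.
Proof.
move=> k0; have [q kq q_pr] := prime_above k.
have [C hC] := dense_pair_biregular q_pr.
exists (8 * C)%N => T e J e_simple hJ he.
have [|S hS] := @dense_pair_crossing _ _ e_simple (C * J.+1).
  by rewrite -mulnA mulnA.
have [F sF rF] := hC _ _ _ _ _ _ (card_nbrB_crossing e_simple S) hJ (leqnn _) hS.
have [|F' sF' rF'] := @biregular_lower _ _ k _ _ _ rF; first by rewrite k0 ltnW.
exact: biregular_crossing (subset_trans sF' sF) rF'.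
Qed.

(* Real logarithms and the choice of the constant *)
From Stdlib Require Import Reals Lra.

Lemma INR_expn m n : INR (expn m n) = (INR m ^ n)%R.
Proof. by elim: n => [|n IH]; rewrite ?expn0 // expnS mult_INR IH. Qed.

Lemma le_log2 (a b : nat) (x : R) : (0 < x)%R -> (2 ^ a <= x ^ b)%R ->
  (INR a <= INR b * log2 x)%R.
Proof.
move=> x0 h; have l2 : (0 < ln 2)%R by have := ln_lt_2; Lra.lra.
have p0 : (0 < 2 ^ a)%R by apply: pow_lt; Lra.lra.
have : (ln (2 ^ a) <= ln (x ^ b))%R.
  by case: h => [h|->]; [left; apply: ln_increasing | right].
rewrite !ln_pow //; last by Lra.lra.
move=> {}h; apply: (Rmult_le_reg_r (ln 2)) => //.
rewrite /log2 /Rdiv !Rmult_assoc Rinv_l ?Rmult_1_r //; Lra.lra.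
Qed.

Lemma loglog_index n : (3 <= n)%N -> exists j : nat,
  [/\ (n < expn 2 (expn 2 j.+1))%N, (INR j <= log2 (log2 (INR n)))%R
    & (1 <= 2 * log2 (log2 (INR n)))%R].
Proof.
move=> n3; have n0 : (0 < n)%N by apply: leq_trans n3.
have /andP[h1 h2] := trunc_log_bounds (isT : (1 < 2)%N) n0.
move: h1 h2; set m := trunc_log 2 n => h1 h2.
have m0 : (0 < m)%N by case: m h2 {h1} => //; rewrite ltnNge (ltnW n3).
have /andP[h3 h4] := trunc_log_bounds (isT : (1 < 2)%N) m0.
move: h3 h4; set j := trunc_log 2 m => h3 h4.
have n3R : (3 <= INR n)%R.
  by have := le_INR 3 n (elimT ssrnat.leP n3); rewrite /=; Lra.lra.
(* [2 ^ 3 <= 3 ^ 2] gives [log2 n >= 3 / 2]; at the end [2 <= (3 / 2) ^ 2] gives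
   [log2 (log2 n) >= 1 / 2]. *)
have L1 : (3 <= 2 * log2 (INR n))%R.
  have := @le_log2 3 2 (INR n); rewrite /=; Lra.nra.
have Lj : (2 ^ j <= log2 (INR n))%R.
  have h : (expn 2 (expn 2 j) <= n)%N by apply: leq_trans h1; rewrite leq_pexp2l.
  have := le_INR _ _ (elimT ssrnat.leP h); rewrite INR_expn => {}h.
  have := @le_log2 (expn 2 j) 1 (INR n); rewrite INR_expn /= in h *.
  by rewrite Rmult_1_l Rmult_1_r => H; apply: H => //; Lra.lra.
exists j; split.
- by apply: leq_trans h2 _; rewrite leq_pexp2l.
- by have := @le_log2 j 1 (log2 (INR n)); rewrite /= Rmult_1_l Rmult_1_r; apply=> //; Lra.lra.
- by have := @le_log2 1 2 (log2 (INR n)); rewrite /= !Rmult_1_r; apply; Lra.nra.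
Qed.

Lemma max_degree_le_card (T : finType) (e : rel T) : (max_degree e <= #|T|)%N.
Proof. by apply/bigmax_leqP => v _; apply: max_card. Qed.

Theorem theorem1p2 :
  forall k : nat, (0 < k)%N ->
  exists C : R,
    (forall (T : finType) (e : rel T), simple_graph e ->
       (3 <= max_degree e)%N ->
       (avg_degree e >= C * log2 (log2 (INR (max_degree e))))%R ->
       has_k_regular_subgraph e k) /\
    (forall (T : finType) (e : rel T), simple_graph e ->
       (3 <= #|T|)%N ->
       (avg_degree e >= C * log2 (log2 (INR #|T|)))%R ->
       has_k_regular_subgraph e k).
Proof.
move=> k k0; have [C0 hC0] := regular_subgraph_nat k0.
(* With [L] the double logarithm, [j.+2 <= 5 L] because [j <= L] and [1 <= 2 L]; the average degree
   counts edges twice, hence 10, and the summand 2 makes the final inequality strict. *)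
exists (10 * INR C0 + 2)%R.
suff main (T : finType) (e : rel T) n : simple_graph e -> (3 <= n)%N ->
    (max_degree e <= n)%N -> (0 < #|T|)%N ->
    (avg_degree e >= (10 * INR C0 + 2) * log2 (log2 (INR n)))%R ->
    has_k_regular_subgraph e k.
  split=> T e e_simple n3; last first.
    by apply: main => //; [apply: max_degree_le_card | apply: leq_trans n3].
  by apply: main => //; apply: leq_trans (max_degree_le_card e); apply: leq_trans n3.
move=> e_simple n3 hn T0 havg.
have [j [nj jL L2]] := loglog_index n3.
apply: (hC0 T e j.+1) => //; first exact: leq_ltn_trans hn nj.
apply/ssrnat.ltP/INR_lt; rewrite !mult_INR.
have T0R : (0 < INR #|T|)%R by apply: lt_0_INR; apply/ssrnat.ltP.
move: havg; rewrite /avg_degree => /Rge_le havg.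
have {}havg : ((10 * INR C0 + 2) * log2 (log2 (INR n)) * INR #|T| <= 2 * INR (num_edges e))%R.
  have -> : (2 * INR (num_edges e) = 2 * INR (num_edges e) / INR #|T| * INR #|T|)%R.
    by rewrite /Rdiv Rmult_assoc Rinv_l ?Rmult_1_r //; Lra.lra.
  by apply: Rmult_le_compat_r havg; Lra.lra.
have C0R := pos_INR C0.
have h : (INR j.+2 <= 5 * log2 (log2 (INR n)))%R by rewrite !S_INR; Lra.lra.
have h2 : (INR C0 * INR j.+2 <= INR C0 * (5 * log2 (log2 (INR n))))%R.
  by apply: Rmult_le_compat_l.
have h3 : (INR C0 * INR j.+2 * INR #|T| <= INR C0 * (5 * log2 (log2 (INR n))) * INR #|T|)%R.
  by apply: Rmult_le_compat_r h2; Lra.lra.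
have h4 : (0 < log2 (log2 (INR n)) * INR #|T|)%R by apply: Rmult_lt_0_compat; Lra.lra.
Lra.lra.
Qed.
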